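(* Let $X$ be a Banach space and $(\mathcal A(t))_{t\in\mathbb R}$ a family of linear operators on $X$ satisfying: (P1) $\mathcal D=\mathcal D(\mathcal A(t))$ is independent of $t$; (P2) each $\mathcal A(t)$ is sectorial and generates an analytic semigroup, the resolvent $R(z,\mathcal A(t))$ exists for all $z\in\mathbb C$ with $\mathrm{Re}\,z\ge0$ with $\|R(z,\mathcal A(t))\|\le M_0/(|z|+1)$ for some $M_0\ge1$ independent of $t$, and $\|e^{\tau\mathcal A(t)}\|\le e^{\omega\tau}$ for all $\tau\ge0$, $t\in\mathbb R$; (P3) there are $L\ge0$, $0<\theta\le1$ with $\|(\mathcal A(t)-\mathcal A(s))\mathcal A(0)^{-1}\|\le L|t-s|^\theta$ for all $t,s$; and (H) there are $0\le\alpha<\beta$ and $C>0$ such that $\|(\mathcal A(t)-\mathcal A(s))x\|\le C|t-s|^\beta\|\mathcal A(\tau)x\|^\alpha\|x\|^{1-\alpha}$ for all $x\in\mathcal D$ and all $s\le\tau\le t$. Let $\mathcal U(t,s)$ be the evolution family solving $u'(t)=\mathcal A(t)u(t)$, with $\|\mathcal U(t,s)\|\le e^{\omega(t-s)}$. Then for every $T>0$ there is $C(T)$ such that for all integers $M\ge1$, with $\Delta t=T/M$, $$\Big\|\mathcal U(T,0)-\prod_{k=0}^{M-1}e^{\Delta t\mathcal A(k\Delta t)}\Big\|_X\le C(T)(\Delta t)^{\beta-\alpha}.$$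
   Context: An evolution family solving the non-autonomous Cauchy problem $u'(t)=\mathcal A(t)u(t)$, $u(s)=x$, is a family of bounded operators $\mathcal U(t,s)$, $t\ge s$, with $\mathcal U(t,r)\mathcal U(r,s)=\mathcal U(t,s)$, $\mathcal U(t,t)=\mathrm{Id}$, strongly continuous in $(t,s)$, such that $t\mapsto\mathcal U(t,s)x$ is the classical solution for $x$ in a dense subspace. Products are ordered $\prod_{k=0}^{M-1}Q_k:=Q_{M-1}\cdots Q_0$. *)

(* Defs.v *)
From HB Require Import structures.
From mathcomp Require Import all_boot all_order all_algebra.
From mathcomp Require Import all_classical all_reals all_analysis.
From mathcomp Require Import complex.
Set Implicit Arguments. Unset Strict Implicit. Unset Printing Implicit Defensive.
Import Order.TTheory GRing.Theory Num.Theory.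
Import numFieldNormedType.Exports.
Local Open Scope classical_set_scope.
Local Open Scope ring_scope.
Local Open Scope complex_scope.

Section Defs.
Variables (R : realType) (X : completeNormedModType R[i]).

Definition nrm (x : X) : R := complex.Re `|x|.
Definition cabs (z : R[i]) : R := complex.Re `|z|.

Definition linear_op (f : X -> X) :=
  forall (a : R[i]) (x y : X), f (a *: x + y) = a *: f x + f y.
Definition bounded_op (f : X -> X) :=
  linear_op f /\ exists c : R, forall x, nrm (f x) <= c * nrm x.
Definition opnorm_le (f : X -> X) (c : R) := forall x, nrm (f x) <= c * nrm x.

Definition subspace (D : set X) :=
  D 0 /\ forall (a : R[i]) x y, D x -> D y -> D (a *: x + y).
(* A : D -> X is linear (values of A outside D are irrelevant) *)
Definition linear_on (D : set X) (A : X -> X) :=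
  subspace D /\ forall (a : R[i]) x y, D x -> D y -> A (a *: x + y) = a *: A x + A y.

Definition is_resolvent (D : set X) (A : X -> X) (z : R[i]) (Rz : X -> X) :=
  [/\ bounded_op Rz,
      forall y, D (Rz y) /\ z *: Rz y - A (Rz y) = y &
      forall x, D x -> Rz (z *: x - A x) = x].

Definition in_resolvent_set (D : set X) (A : X -> X) (z : R[i]) :=
  exists Rz, is_resolvent D A z Rz.

(* Sectorial operator (Lunardi): there are w0 in R, theta in (pi/2, pi) and
   M > 0 with  S_{theta,w0} = {l <> w0 : |arg (l - w0)| < theta} in rho(A)
   and ||R(l,A)|| <= M / |l - w0| there.  Writing kappa = tan (pi - theta) > 0,
   the condition |arg w| < theta for w <> 0 reads:
   Re w > 0 or |Im w| > kappa * (- Re w). *)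
Definition sectorial (D : set X) (A : X -> X) :=
  linear_on D A /\
  exists (w0 kappa M : R), 0 < kappa /\ 0 < M /\
    forall l : R[i], l != w0%:C ->
      (0 < complex.Re (l - w0%:C) \/
       kappa * (- complex.Re (l - w0%:C)) < `|complex.Im (l - w0%:C)|) ->
      exists Rl, is_resolvent D A l Rl /\ opnorm_le Rl (M / cabs (l - w0%:C)).

Definition has_deriv (u : R -> X) (t : R) (v : X) :=
  (fun h : R => (h%:C)^-1 *: (u (t + h) - u t)) @ 0^' --> v.
Definition has_rderiv (u : R -> X) (t : R) (v : X) :=
  (fun h : R => (h%:C)^-1 *: (u (t + h) - u t)) @ 0^'+ --> v.

Definition generates_C0 (D : set X) (A : X -> X) (S : R -> X -> X) :=
  (forall tau, 0 <= tau -> bounded_op (S tau)) /\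
  [/\ forall x, S 0 x = x,
      forall tau sigma, 0 <= tau -> 0 <= sigma ->
        forall x, S (tau + sigma) x = S tau (S sigma x),
      forall x, {within `[0, +oo[, continuous (fun tau => S tau x)},
      forall x, D x <-> (exists v, has_rderiv (fun tau => S tau x) 0 v) &
      forall x, D x -> has_rderiv (fun tau => S tau x) 0 (A x)].

(* open sector {z : Re z > 0, |Im z| < k Re z} (k = tan delta) *)
Definition csector (k : R) (z : R[i]) :=
  0 < complex.Re z /\ `|complex.Im z| < k * complex.Re z.

Definition analytic_semigroup (S : R -> X -> X) :=
  exists (k : R) (Se : R[i] -> X -> X), 0 < k /\
   [/\ forall z, csector k z -> bounded_op (Se z),
       forall z w, csector k z -> csector k w ->
          forall x, Se (z + w) x = Se z (Se w x),
       forall x z, csector k z -> derivable (fun w : R[i]^o => Se w x) z 1,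
       forall tau, 0 < tau -> forall x, Se tau%:C x = S tau x &
       forall x, (fun z : R[i]^o => Se z x) @ within (csector k) (nbhs (0 : R[i]^o)) --> x].

Fixpoint oprod (Q : nat -> X -> X) (n : nat) : X -> X :=
  match n with
  | 0 => id
  | n'.+1 => Q n' \o oprod Q n'
  end.

Definition classical_solution (D : set X) (A : R -> X -> X) (s : R) (x : X)
    (u : R -> X) :=
  [/\ u s = x,
      {within `[s, +oo[, continuous u},
      forall t, s < t -> D (u t) &
      forall t, s < t -> has_deriv u t (A t (u t))
        /\ {for t, continuous (fun r => A r (u r))}].

Definition evolution_family (D : set X) (A : R -> X -> X) (U : R -> R -> X -> X) :=
  [/\ forall t s, s <= t -> bounded_op (U t s),
      forall t r s, s <= r -> r <= t -> forall x, U t r (U r s x) = U t s x,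
      forall t x, U t t x = x,
      forall x, {within [set p : R * R | p.2 <= p.1],
                  continuous (fun p => U p.1 p.2 x)} &
      exists Y : set X, [/\ subspace Y, closure Y = setT &
        forall s x, Y x -> classical_solution D A s x (fun t => U t s x)]].

End Defs.

(* Main.v *)
Require Import Defs.
From HB Require Import structures.
From mathcomp Require Import all_boot all_order all_algebra.
From mathcomp Require Import all_classical all_reals all_analysis.
From mathcomp Require Import complex zify ring lra.
Import Order.TTheory GRing.Theory Num.Theory.
Import numFieldNormedType.Exports.
Local Open Scope classical_set_scope.
Local Open Scope ring_scope.

(** Freezing the generator at the left end of [s, s + h] and then refreezing it
  at the midpoint changes the propagator by
  [(e^{(h/2) A(s+h/2)} - e^{(h/2) A(s)}) e^{(h/2) A(s)}].  Variation of constants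
  and (H) with [tau = s] bound this by a multiple of
  [h * h^beta * ||A(s) e^{(h/2) A(s)}||^alpha], that is of [h^(1 + beta - alpha)],
  so only the smoothing of the autonomous semigroups is needed.  Summing over
  dyadic refinements, the frozen propagator over [s, s + h] is
  [O(h^(1 + beta - alpha))]-close to the limit of its refinements, and along a
  classical solution this limit is the evolution family.  Telescoping the local
  errors gives the theorem.  If [alpha >= 1] then [beta > 1], and (H) forces
  [A(t)] to be independent of [t].

  The smoothing bound [||A S(tau)|| <= K / tau], uniform in [t], comes from the
  resolvent bound on the closed right half-plane without contour integrals: for
  [T = l R(l, A)] with [l = n / tau], the resolvents of [T] at the [2n]-th roots
  of [-1] determine [T^n] by a finite sum; two summations by parts yield
  [||T^n (1 - T)|| = O(1/n)], that is [||A T^(n+1)|| = O(1/tau)], and [T^n] tends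
  to [S(tau)]. *)

Local Open Scope complex_scope.
Set Implicit Arguments.
Unset Strict Implicit.

(** * Norms, right derivatives and the mean value inequality *)

Section Norm.
Variables (R : realType) (X : completeNormedModType R[i]).
Implicit Types (x y z : X) (a : R[i]) (r : R).

Lemma nrmE x : `|x| = (nrm x)%:C.
Proof.
have := normr_ge0 x; rewrite lecE => /andP[/eqP i0 _].
by rewrite /nrm {1}[`|x|]complexE i0 /= mulr0 addr0.
Qed.

Lemma cabsE a : `|a| = (cabs a)%:C.
Proof.
have := normr_ge0 a; rewrite lecE => /andP[/eqP i0 _].
by rewrite /cabs {1}[`|a|]complexE i0 /= mulr0 addr0.
Qed.

Lemma nrm_ge0 x : 0 <= nrm x.
Proof. by have := normr_ge0 x; rewrite lecE => /andP[]. Qed.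

Lemma cabs_ge0 a : 0 <= cabs a.
Proof. by have := normr_ge0 a; rewrite lecE => /andP[]. Qed.

Lemma nrmD x y : nrm (x + y) <= nrm x + nrm y.
Proof. by have := ler_normD x y; rewrite !nrmE -rmorphD /= lecR. Qed.

Lemma nrmZ a x : nrm (a *: x) = cabs a * nrm x.
Proof. by rewrite /nrm normrZ cabsE nrmE -rmorphM. Qed.

Lemma nrmN x : nrm (- x) = nrm x.
Proof. by rewrite /nrm normrN. Qed.

Lemma nrm0 : nrm (0 : X) = 0.
Proof. by rewrite /nrm normr0. Qed.

Lemma nrmBC x y : nrm (x - y) = nrm (y - x).
Proof. by rewrite -nrmN opprB. Qed.

Lemma nrmB x y : nrm (x - y) <= nrm x + nrm y.
Proof. by rewrite (le_trans (nrmD _ _))// nrmN. Qed.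

Lemma nrm_tri y x z : nrm (x - z) <= nrm (x - y) + nrm (y - z).
Proof. by rewrite -(subrKA y) nrmD. Qed.

Lemma nrm_eq0 x : nrm x = 0 -> x = 0.
Proof. by move=> x0; apply/eqP; rewrite -normr_eq0 nrmE x0. Qed.

Lemma nrm_sum (I : Type) (s : seq I) (P : pred I) (F : I -> X) :
  nrm (\sum_(i <- s | P i) F i) <= \sum_(i <- s | P i) nrm (F i).
Proof.
elim/big_ind2: _ => [|u a v b ha hb|//]; first by rewrite nrm0.
by rewrite (le_trans (nrmD _ _))// lerD.
Qed.

Lemma cabs_real r : cabs r%:C = `|r|.
Proof. by rewrite /cabs normc_def /= expr0n/= addr0 sqrtr_sqr. Qed.

Lemma cabsM a b : cabs (a * b) = cabs a * cabs b.
Proof. by rewrite /cabs normrM !cabsE -rmorphM. Qed.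

Lemma cabs1 : cabs (1 : R[i]) = 1.
Proof. by rewrite /cabs normr1. Qed.

Lemma cabsX a n : cabs (a ^+ n) = cabs a ^+ n.
Proof. by elim: n => [|n IH]; rewrite ?expr0 ?cabs1// !exprS cabsM IH. Qed.

Lemma cabsN a : cabs (- a) = cabs a.
Proof. by rewrite /cabs normrN. Qed.

Lemma cabsD a b : cabs (a + b) <= cabs a + cabs b.
Proof. by have := ler_normD a b; rewrite !cabsE -rmorphD /= lecR. Qed.

Lemma cabs_gt0 a : a != 0 -> 0 < cabs a.
Proof.
by rewrite -normr_gt0 cabsE ltcE /= => /andP[].
Qed.

Lemma nrmZr r x : nrm (r%:C *: x) = `|r| * nrm x.
Proof. by rewrite nrmZ cabs_real. Qed.

Lemma nrm_le_eps x y (c : R) : 0 <= c ->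
  (forall e : R, 0 < e -> nrm (x - y) <= c * e) -> x = y.
Proof.
move=> c0 h; apply/eqP; rewrite -subr_eq0; apply/eqP/nrm_eq0.
apply/eqP; rewrite eq_le nrm_ge0 andbT; apply/ler_addgt0Pl => e e0.
rewrite addr0; have d0 : 0 < c + 1 by rewrite ltr_wpDl.
apply: (le_trans (h (e / (c + 1)) (divr_gt0 e0 d0))).
by rewrite mulrCA ger_pMr// ler_pdivrMr// mul1r lerDl.
Qed.

End Norm.

Section Limits.
Variables (R : realType) (X : completeNormedModType R[i]).
Implicit Types (u : R -> X) (t : R) (v : X).

(** The right derivative as a first-order expansion with real tolerances: no division by [h], and no
    use of the partial order of [R[i]]. [contpt] treats continuity in the same way. *)
Definition rder u t v := forall e : R, 0 < e -> exists2 d : R, 0 < d &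
  forall h, 0 < h -> h < d -> nrm (u (t + h) - u t - h%:C *: v) <= e * h.

Lemma nrm_cvgP (T : Type) (F : set_system T) (FF : Filter F) (f : T -> X) v :
  f x @[x --> F] --> v <->
  (forall e : R, 0 < e -> \forall x \near F, nrm (v - f x) <= e).
Proof.
split=> [/cvgrPdist_le h e e0|h].
  have := h e%:C; rewrite ltcR => /(_ e0); apply: filterS => x.
  by rewrite nrmE lecR.
apply/cvgrPdist_le => e; rewrite ltcE /= => /andP[/eqP i0 r0].
have := h _ r0; apply: filterS => x; rewrite nrmE lecE /=.
by rewrite i0 eqxx.
Qed.

Lemma quotient_nrm u t v (h : R) : 0 < h ->
  nrm (u (t + h) - u t - h%:C *: v) =
  h * nrm (v - (h%:C)^-1 *: (u (t + h) - u t)).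
Proof.
move=> h0; have hC : h%:C != 0 by rewrite fmorph_eq0 gt_eqF.
move: (u (t + h) - u t) => q.
by rewrite -{2}(gtr0_norm h0) -nrmZr scalerBr scalerA mulfV// scale1r nrmBC.
Qed.

Lemma nbhs_rightP (P : R -> Prop) t :
  (\forall h \near t^'+, P h) <->
  (exists2 d : R, 0 < d & forall h, t < h -> h < t + d -> P h).
Proof.
split=> [|[d d0 h]].
  move=> /nbhs_ballP[d /= d0 hd]; exists d => // h th htd; apply: hd => //=.
  rewrite /ball /= ltr_norml; apply/andP; split; lra.
apply/nbhs_ballP; exists d => //= y; rewrite /ball /= ltr_norml => /andP[a b] ty.
by apply: h => //; lra.
Qed.

Lemma has_rderivP u t v : has_rderiv u t v <-> rder u t v.
Proof.
split=> [/nrm_cvgP hu e e0|hu].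
  have /nbhs_rightP[d d0 hd] := hu _ e0; exists d => // h h0 hd'.
  rewrite quotient_nrm// mulrC ler_wpM2r//; first exact: ltW.
  by apply: hd => //; rewrite add0r.
apply/nrm_cvgP => e e0; have [d d0 hd] := hu _ e0.
apply/nbhs_rightP; exists d => // h h0; rewrite add0r => hd'.
by have := hd h h0 hd'; rewrite quotient_nrm// mulrC ler_pM2r.
Qed.

Lemma has_deriv_rder u t v : has_deriv u t v -> rder u t v.
Proof. by move=> /cvg_dnbhs_at_right/has_rderivP. Qed.

Lemma rder_unique u t v w : rder u t v -> rder u t w -> v = w.
Proof.
move=> hv hw; apply: (@nrm_le_eps _ _ _ _ 2) => // e e0.
have [d1 d10 h1] := hv _ e0; have [d2 d20 h2] := hw _ e0.
pose h := Num.min d1 d2 / 2.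
have m0 : 0 < Num.min d1 d2 by rewrite lt_min d10.
have h0 : 0 < h by rewrite divr_gt0.
have hm : h < Num.min d1 d2 by rewrite /h; lra.
move: (hm); rewrite lt_min => /andP[a b].
have A := h1 h h0 a; have B := h2 h h0 b.
rewrite -(ler_pM2l h0) -[h in X in X <= _]gtr0_norm// -nrmZr scalerBr.
have -> : h%:C *: v - h%:C *: w = (u (t + h) - u t - h%:C *: w)
   - (u (t + h) - u t - h%:C *: v).
  by rewrite [RHS]addrC opprB subrKA.
rewrite (le_trans (nrmB _ _))//; lra.
Qed.

Definition contpt (P : set R) u t := forall e : R, 0 < e -> exists2 d : R, 0 < d &
  forall t', P t' -> `|t' - t| < d -> nrm (u t' - u t) <= e.

Lemma within_contpt (P : set R) u t :
  {within P, continuous u} -> P t -> contpt P u t.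
Proof.
move=> /subspace_continuousP/(_ t) h /h/nrm_cvgP {}h e /h.
move=> /nbhs_ballP[d /= d0 hd]; exists d => // t' Pt' tt'.
by rewrite nrmBC; apply: hd => //; rewrite /ball /= distrC.
Qed.

(* A continuous induction on the right derivative avoids both integrals and
   the Hahn-Banach theorem. *)
Lemma mean_value_le u (a b B : R) : a <= b -> 0 <= B ->
  (forall s, a <= s <= b -> contpt `[a, b] u s) ->
  (forall s, a <= s < b -> forall e : R, 0 < e -> exists2 d : R, 0 < d &
     forall h, 0 < h -> h < d -> nrm (u (s + h) - u s) <= (B + e) * h) ->
  nrm (u b - u a) <= B * (b - a).
Proof.
move=> ab B0 cu du.
have main (e : R) : 0 < e -> nrm (u b - u a) <= (B + e) * (b - a).
  move=> e0; pose P t := nrm (u t - u a) <= (B + e) * (t - a).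
  (* The supremum of [E] lies in [E] by continuity, and if it were below [b] the local estimate with
     slack [e] would exceed it. *)
  pose E := [set t | a <= t <= b /\ P t].
  have Ea : E a by split; rewrite ?lexx ?ab//= /P !subrr nrm0 mulr0.
  have sE : has_sup E.
    by split; [exists a|exists b => t [/andP[]]].
  have ubE := sup_upper_bound sE.
  set c := sup E in ubE *.
  have ac : a <= c by exact: ubE.
  have cb : c <= b by apply: ge_sup; [exists a|move=> t [/andP[]]].
  have Pc : P c.
    rewrite /P; apply/ler_addgt0Pl => n n0.
    have [|d d0 hd] := cu c _ n n0; first by rewrite ac.
    have [t [/andP[at_ tb] Pt] tc] := sup_adherent d0 sE.
    have tc' : t <= c by apply: ubE; split=> //; rewrite at_.
    have := hd t; rewrite /= in_itv /= at_ tb => /(_ isT).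
    rewrite ltr_norml => /(_ _) ht.
    have {}ht : nrm (u t - u c) <= n by apply: ht; apply/andP; split; rewrite -/c in tc *; lra.
    rewrite (le_trans (nrm_tri (u t) _ _))// lerD//; first by rewrite nrmBC.
    by apply: (le_trans Pt); rewrite ler_wpM2l//; lra.
  have [cb'|cb'|<-//] := ltgtP c b; last by rewrite leNgt cb' in cb.
  have [|d d0 hd] := du c _ e e0; first by rewrite ac.
  pose h := Num.min (d / 2) (b - c).
  have h0 : 0 < h by rewrite lt_min divr_gt0//= subr_gt0.
  have hb : h <= b - c by rewrite ge_min lexx orbT.
  have hd' : h < d by rewrite gt_min; apply/orP; left; lra.
  suff : E (c + h) by move/ubE; lra.
  split; first by apply/andP; split; lra.
  rewrite /P (le_trans (nrm_tri (u c) _ _))//.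
  have := hd h h0 hd'; rewrite /P in Pc; lra.
have [<-|ab'] := eqVneq a b; first by rewrite !subrr nrm0 mulr0.
have ba : 0 < b - a by rewrite subr_gt0 lt_neqAle ab'.
apply/ler_addgt0Pl => e e0; have := main (e / (b - a)) (divr_gt0 e0 ba).
by rewrite mulrDl divfK ?gt_eqF// [_ + e]addrC.
Qed.

End Limits.

Lemma subrBB (V : zmodType) (a b c d : V) : a - b - (c - d) = (a - c) - (b - d).
Proof. by rewrite !opprB [d - c]addrC [d - b]addrC addrACA. Qed.

(** * Strongly continuous semigroups *)

Section LinearOp.
Variables (R : realType) (X : completeNormedModType R[i]) (f : X -> X).
Hypothesis lf : linear_op f.

Lemma lin0 : f 0 = 0.
Proof. by have := lf 1 0 0; rewrite !scale1r !addr0 => /eqP; rewrite -subr_eq subrr eq_sym => /eqP. Qed.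

Lemma linZ a x : f (a *: x) = a *: f x.
Proof. by have := lf a x 0; rewrite lin0 !addr0. Qed.

Lemma linD x y : f (x + y) = f x + f y.
Proof. by have := lf 1 x y; rewrite !scale1r. Qed.

Lemma linN x : f (- x) = - f x.
Proof. by rewrite -scaleN1r linZ scaleN1r. Qed.

Lemma linB x y : f (x - y) = f x - f y.
Proof. by rewrite linD linN. Qed.

Lemma lin_sum (I : Type) (s : seq I) (F : I -> X) :
  f (\sum_(i <- s) F i) = \sum_(i <- s) f (F i).
Proof.
elim: s => [|i s IH]; first by rewrite !big_nil lin0.
by rewrite !big_cons linD IH.
Qed.

End LinearOp.

Section LinearOn.
Variables (R : realType) (X : completeNormedModType R[i]).
Variables (D : set X) (A : X -> X).
Hypothesis lA : linear_on D A.

Lemma lon0D : D 0. Proof. by case: lA => [[]]. Qed.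

Lemma lonZD a x : D x -> D (a *: x).
Proof. by case: lA => [[d0 h] _] Dx; rewrite -[_ *: _]addr0; exact: h. Qed.

Lemma lonDD x y : D x -> D y -> D (x + y).
Proof. by case: lA => [[d0 h] _] Dx Dy; rewrite -[x]scale1r; exact: h. Qed.

Lemma lonD x y : D x -> D y -> A (x + y) = A x + A y.
Proof. by case: lA => _ h Dx Dy; have := h 1 x y Dx Dy; rewrite !scale1r. Qed.

Lemma lon0 : A 0 = 0.
Proof.
have := lonD lon0D lon0D; rewrite addr0 => /eqP.
by rewrite -subr_eq subrr eq_sym => /eqP.
Qed.

Lemma lonZ a x : D x -> A (a *: x) = a *: A x.
Proof. by case: lA => [_ h] Dx; have := h a x 0 Dx lon0D; rewrite lon0 !addr0. Qed.

End LinearOn.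

Section Semigroup.
Variables (R : realType) (X : completeNormedModType R[i]).
Variables (D : set X) (A : X -> X) (S : R -> X -> X) (w : R).
Hypothesis lA : linear_on D A.
Hypothesis gS : generates_C0 D A S.
Hypothesis w0 : 0 <= w.
Hypothesis bS : forall tau, 0 <= tau -> opnorm_le (S tau) (expR (w * tau)).

Lemma sg_lin tau : 0 <= tau -> linear_op (S tau).
Proof. by case: gS => h _ /h[]. Qed.

Lemma sg0 x : S 0 x = x.
Proof. by case: gS => _ []. Qed.

Lemma sgD s t x : 0 <= s -> 0 <= t -> S (s + t) x = S s (S t x).
Proof. by case: gS => _ [_ h _ _ _] s0 t0; rewrite h. Qed.

Lemma sgC s t x : 0 <= s -> 0 <= t -> S s (S t x) = S t (S s x).
Proof. by move=> s0 t0; rewrite -!sgD// addrC. Qed.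

Lemma sg_rderP x v : has_rderiv (fun tau => S tau x) 0 v <->
  (forall e : R, 0 < e -> exists2 d : R, 0 < d &
  forall h, 0 < h -> h < d -> nrm (S h x - x - h%:C *: v) <= e * h).
Proof.
rewrite has_rderivP; split=> H e /H[d d0 h]; exists d => // k k0 kd;
  by have := h k k0 kd; rewrite add0r sg0.
Qed.

Lemma sg_der x : D x -> forall e : R, 0 < e -> exists2 d : R, 0 < d &
  forall h, 0 < h -> h < d -> nrm (S h x - x - h%:C *: A x) <= e * h.
Proof. by case: gS => _ [_ _ _ _ h] /h/sg_rderP. Qed.

(** [generates_C0] makes the domain exactly the set of vectors with right differentiable orbit at 0,
    so an expansion yields membership and, by uniqueness of the derivative, the value of [A]. *)
Lemma sg_gen x v : (forall e : R, 0 < e -> exists2 d : R, 0 < d &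
  forall h, 0 < h -> h < d -> nrm (S h x - x - h%:C *: v) <= e * h) ->
  D x /\ A x = v.
Proof.
move=> /sg_rderP hv; case: gS => _ [_ _ _ hD hA].
have Dx : D x by apply/hD; exists v.
split=> //; have /has_rderivP h1 := hA x Dx; move/has_rderivP: hv => h2.
exact: rder_unique h1 h2.
Qed.

Lemma sg_bound tau k x : 0 <= tau -> tau <= k -> nrm (S tau x) <= expR (w * k) * nrm x.
Proof.
move=> t0 tk; apply: (le_trans (bS t0 x)); rewrite ler_wpM2r ?nrm_ge0//.
by rewrite ler_expR ler_wpM2l.
Qed.

(** The semigroup commutes with itself, so the expansion at 0 of the orbit of [S s x] is [S s]
    applied to that of [x]. *)
Lemma sg_dom s x : 0 <= s -> D x -> D (S s x) /\ A (S s x) = S s (A x).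
Proof.
move=> s0 Dx; apply: sg_gen => e e0.
have [d d0 h] := sg_der Dx (divr_gt0 e0 (expR_gt0 (w * s))).
exists d => // k k0 kd; rewrite sgC ?(ltW k0)//.
rewrite -(linZ (sg_lin s0)) -!(linB (sg_lin s0)).
apply: (le_trans (bS s0 _)).
have -> : e * k = expR (w * s) * (e / expR (w * s) * k).
  by rewrite mulrA mulrCA mulfV ?mulr1// gt_eqF// expR_gt0.
by rewrite ler_pM2l ?expR_gt0//; exact: h.
Qed.

Lemma sg_cont x t : 0 <= t -> contpt `[0, +oo[ (fun s => S s x) t.
Proof.
move=> t0; case: gS => _ [_ _ h _ _]; apply: within_contpt; first exact: h.
by rewrite /= in_itv /= t0.
Qed.

(** Variation of constants without an integral: [S (a + k - s) (v s)] moves with velocity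
    [S (a + k - s) (v' - A (v s))], of norm at most [expR (w * k) * B], and the mean value
    inequality applies to it. *)
Lemma sg_compare (v : R -> X) (a k B : R) : 0 <= k -> 0 <= B ->
  (forall s, a <= s <= a + k -> contpt `[a, a + k] v s) ->
  (forall s, a <= s < a + k -> D (v s) /\
     exists2 v', rder v s v' & nrm (v' - A (v s)) <= B) ->
  nrm (v (a + k) - S k (v a)) <= expR (w * k) * B * k.
Proof.
move=> k0 B0 cv dv; pose E := expR (w * k).
have E0 : 0 < E by exact: expR_gt0.
pose u s := S (a + k - s) (v s).
have -> : v (a + k) = u (a + k) by rewrite /u subrr sg0.
have -> : S k (v a) = u a by rewrite /u addrAC subrr add0r.
have <- : (E * B) * (a + k - a) = E * B * k by rewrite addrAC subrr add0r.
apply: mean_value_le; [lra|by rewrite mulr_ge0 ?(ltW E0)| |].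
- move=> s sk e e0; pose e' := e / (E + 1) / 2.
  have EE : 0 < E + 1 by rewrite ltr_wpDl// ltW.
  have e'0 : 0 < e' by rewrite !divr_gt0.
  have [d1 d10 h1] := cv s sk _ e'0.
  have ask : 0 <= a + k - s by move: sk; lra.
  have [d2 d20 h2] := sg_cont (v s) ask e'0.
  exists (Num.min d1 d2); first by rewrite lt_min d10.
  move=> t tI; rewrite lt_min => /andP[td1 td2].
  move: (tI); rewrite /= in_itv /= => /andP[at_ tk].
  apply: (le_trans (nrm_tri (S (a + k - t) (v s)) _ _)).
  have -> : e = (E + 1) * e' + (E + 1) * e' by rewrite -mulrDr /e' -splitr mulrCA mulfV ?gt_eqF// mulr1.
  apply: lerD.
    rewrite /u -(linB (@sg_lin (a + k - t) _)); last by lra.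
    apply: (@le_trans _ _ (E * nrm (v t - v s))); first by apply: sg_bound; lra.
    apply: ler_pM; rewrite ?nrm_ge0 ?(ltW E0)// ?lerDl//.
    exact: h1.
  apply: (@le_trans _ _ e'); last by rewrite ler_peMl ?(ltW e'0)// lerDr ltW.
  apply: h2; first by rewrite /= in_itv /=; lra.
  by rewrite opprB addrC addrA subrK distrC.
- move=> s sk e e0; pose e' := e / E / 2.
  have e'0 : 0 < e' by rewrite !divr_gt0.
  have [Dv [v' rv vB]] := dv s sk.
  have [d1 d10 h1] := rv _ e'0.
  have [d2 d20 h2] := sg_der Dv e'0.
  exists (Num.min (Num.min d1 d2) (a + k - s)); first by rewrite !lt_min d10 d20 /=; move: sk; lra.
  move=> h h0; rewrite !lt_min -andbA => /and3P[hd1 hd2 hk].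
  have -> : u s = S (a + k - (s + h)) (S h (v s)).
    rewrite -sgD; [|lra|lra]; congr (S _ _); ring.
  rewrite /u -(linB (@sg_lin (a + k - (s + h)) _)); last by lra.
  apply: (@le_trans _ _ (E * nrm (v (s + h) - S h (v s)))); first by apply: sg_bound; move: sk; lra.
  have -> : (E * B + e) * h = E * (B * h + (e' * h + e' * h)).
    by rewrite -mulrDl -mulrDl /e' -splitr mulrA mulrDr mulrCA mulfV ?mulr1// gt_eqF.
  rewrite ler_pM2l//.
  have H1 := h1 h h0 hd1; have H2 := h2 h h0 hd2.
  (* The expansions of [v] and of the orbit of [v s] both start at [v s], so to first order only
     their slopes differ. *)
  have -> : v (s + h) - S h (v s) = h%:C *: (v' - A (v s)) +
     ((v (s + h) - v s - h%:C *: v') - (S h (v s) - v s - h%:C *: A (v s))).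
    by rewrite scalerBr subrBB [- (S h (v s) - v s)]opprB subrKA [RHS]addrC subrK.
  apply: (le_trans (nrmD _ _)); apply: lerD.
    by rewrite nrmZr gtr0_norm// mulrC ler_wpM2r// ltW.
  by apply: (le_trans (nrmB _ _)); apply: lerD.
Qed.

Lemma contpt_affine (x y : X) (P : set R) t : contpt P (fun s => x + s%:C *: y) t.
Proof.
move=> e e0; have y0 : 0 < nrm y + 1 by rewrite ltr_wpDl// nrm_ge0.
exists (e / (nrm y + 1)); first by rewrite divr_gt0.
move=> s _ st; rewrite opprD addrACA subrr add0r -scalerBl -rmorphB nrmZr.
apply: (@le_trans _ _ (e / (nrm y + 1) * (nrm y + 1))); last by rewrite divfK// gt_eqF.
by apply: ler_pM; rewrite ?nrm_ge0// ?(ltW st)// lerDl.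
Qed.

Lemma rder_affine (x y : X) t : rder (fun s => x + s%:C *: y) t y.
Proof.
move=> e e0; exists 1 => // h h0 _.
rewrite opprD addrACA subrr add0r -scalerBl -rmorphB -scalerBl -rmorphB.
rewrite (_ : t + h - t - h = 0); last by ring.
by rewrite scale0r nrm0 mulr_ge0// ltW.
Qed.

(** [sg_compare] for the affine curve [x + s A x], whose defect [- s A (A x)] is at most [h] times
    the norm of [A (A x)]. *)
Lemma sg_taylor x h : 0 <= h -> D x -> D (A x) ->
  nrm (x + h%:C *: A x - S h x) <= expR (w * h) * nrm (A (A x)) * h ^+ 2.
Proof.
move=> h0 Dx DAx; pose v (s : R) := x + s%:C *: A x.
have vD s : D (v s) by apply: (lonDD lA) => //; exact: (lonZD lA).
have := @sg_compare v 0 h (h * nrm (A (A x))) h0.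
rewrite (_ : v 0 = x) ?add0r; last by rewrite /v scale0r addr0.
rewrite (_ : _ * h = expR (w * h) * nrm (A (A x)) * h ^+ 2); last by ring.
apply; first by rewrite mulr_ge0// nrm_ge0.
  by move=> s _; exact: contpt_affine.
move=> s /andP[s0 sh]; split=> //; exists (A x); first exact: rder_affine.
rewrite /v (lonD lA) ?(lonZ lA)//; last exact: (lonZD lA).
rewrite opprD addrA subrr add0r nrmN nrmZr ger0_norm//.
by rewrite ler_wpM2r ?nrm_ge0// ltW.
Qed.

(* The constant 2 w instead of w costs nothing and avoids differentiating exp. *)
Lemma sg_dissipative x (l : R) : D x ->
  (l - 2 * w) * nrm x <= nrm (l%:C *: x - A x).
Proof.
move=> Dx; apply/ler_addgt0Pl => e e0.
have [d d0 H] := sg_der Dx e0.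
have w10 : 0 < w + 1 by rewrite ltr_wpDl.
(* The second bound keeps [h * w] and [h * |l|] at most 1/2, so that
   [expR (w * h) <= 1 + 2 * (w * h)] and [1 + h * l] is nonnegative. *)
pose h := Num.min (d / 2) (1 / 2 / (w + 1) / (1 + `|l|)).
have l10 : 0 < 1 + `|l| by rewrite ltr_pwDl.
have h0 : 0 < h by rewrite lt_min divr_gt0//= !divr_gt0.
have hd : h < d by rewrite gt_min; apply/orP; left; lra.
have hw' : h * (1 + `|l|) * (w + 1) <= 1 / 2.
  have : h <= 1 / 2 / (w + 1) / (1 + `|l|) by rewrite ge_min lexx orbT.
  by rewrite ler_pdivlMr// ler_pdivlMr.
have hl0 : 0 <= h * `|l| by rewrite mulr_ge0// ltW.
have hlw0 : 0 <= h * `|l| * w by rewrite mulr_ge0.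
have hw0 : 0 <= h * w by rewrite mulr_ge0// ltW.
have hw : h * w <= 1 / 2 by lra.
have hl : h * `|l| <= 1 / 2 by lra.
have {H} := H h h0 hd.
have ex : expR (w * h) <= 1 + 2 * (w * h).
  have := expR_ge1Dx (- (w * h)); rewrite expRN => H.
  have E0 := expR_gt0 (w * h).
  have : (1 - w * h) * expR (w * h) <= 1.
    by rewrite -ler_pdivlMr// mul1r.
  nra.
have Sx := le_trans (bS (ltW h0) x) (ler_wpM2r (nrm_ge0 x) ex).
have hC : h%:C != 0 by rewrite fmorph_eq0 gt_eqF.
have key : h%:C *: (l%:C *: x - A x) = (1 + h * l)%:C *: x - S h x + (S h x - x - h%:C *: A x).
  rewrite scalerBr scalerA -rmorphM [(1 + _)%:C]rmorphD scalerDl scale1r.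
  by rewrite [RHS]addrA subrKA [x + _]addrC addrK.
set q := S h x - x - _ in key * => qe.
have : h * nrm (l%:C *: x - A x) >= nrm ((1 + h * l)%:C *: x) - nrm (S h x) - nrm q.
  rewrite -[h in h * nrm _]gtr0_norm// -nrmZr key.
  set p := (1 + h * l)%:C *: x.
  have : nrm p <= nrm (p - S h x + q) + nrm (S h x) + nrm q.
    rewrite -[p in nrm p](_ : (p - S h x + q) + S h x - q = _); last by rewrite addrAC addrK subrK.
    by apply: (le_trans (nrmB _ _)); rewrite lerD2r nrmD.
  lra.
rewrite nrmZr ger0_norm; last first.
  have := ler_norm (- l); rewrite normrN => H1.
  have : h * - l <= h * `|l| by rewrite ler_pM2l.
  lra.
move=> K; rewrite -(ler_pM2l h0); have := nrm_ge0 x; move: K qe Sx => K qe Sx nx0; nra.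
Qed.

End Semigroup.

(** * A resolvent bound for T^n (1 - T) *)

Section RootsOfMinusOne.
Variable R : realType.

Lemma sin_le (x : R) : 0 <= x -> sin x <= x.
Proof.
move=> x0.
have [c _] := @MVT_segment R sin cos 0 x x0 (fun y _ => is_derive_sin y)
  (continuous_subspaceT (@continuous_sin R)).
rewrite sin0 !subr0 => ->.
by rewrite ler_piMl// cos_le1.
Qed.

Lemma expi_expr (t : R) m :
  (cos t +i* sin t) ^+ m = cos (m%:R * t) +i* sin (m%:R * t).
Proof.
elim: m => [|m IH]; first by rewrite expr0 mul0r cos0 sin0.
rewrite exprS IH -natr1 mulrDl mul1r [_ + t]addrC cosD sinD.
by simpc; congr (_ +i* _); rewrite addrC mulrC [X in _ + X]mulrC.
Qed.

Lemma cabs_expi (t : R) : cabs (cos t +i* sin t) = 1.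
Proof. by rewrite /cabs normc_def /= cos2Dsin2 sqrtr1. Qed.

Lemma expi_sqr_sub1 (t : R) : 0 <= sin t ->
  cabs ((cos t +i* sin t) ^+ 2 - 1) = 2 * sin t.
Proof.
move=> s0; rewrite expi_expr /cabs normc_def /=.
rewrite mulr_natl cos_mulr2n sin_mulr2n.
rewrite (_ : _ + _ = (2 * sin t) ^+ 2) ?sqrtr_sqr ?ger0_norm ?mulr_ge0//.
have h : cos t ^+ 2 = 1 - sin t ^+ 2 by rewrite -(cos2Dsin2 t) addrK.
rewrite subr0 [RHS]exprMn h (_ : cos t * sin t *+ 2 = 2 * (cos t * sin t)); last by rewrite mulr_natl.
rewrite [X in _ + X]exprMn [(cos t * _) ^+ 2]exprMn h.
rewrite (_ : _ - 1 - 1 = - 2 * sin t ^+ 2); last by rewrite -mulr_natl; ring.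
ring.
Qed.

(** The root is [exp (i pi / N)]: its square is a primitive [N]-th root of unity at distance
    [2 sin (pi / N)] from 1. *)
Lemma root_of_minus1 (N : nat) : (0 < N)%N -> exists z : R[i],
  [/\ z ^+ N = -1, cabs z = 1,
      forall i, (0 < i < N)%N -> (z ^+ 2) ^+ i != 1 &
      cabs (z ^+ 2 - 1) <= 2 * pi / N%:R].
Proof.
move=> N0; have NR : 0 < N%:R :> R by rewrite ltr0n.
have pi0 := pi_gt0 R.
exists (cos (pi / N%:R) +i* sin (pi / N%:R)); split.
- by rewrite expi_expr mulrC divfK ?gt_eqF// cospi sinpi; simpc.
- exact: cabs_expi.
- move=> i /andP[i0 iN]; rewrite exprAC expi_expr -subr_eq0 -normr_eq0.
  have iR : 0 < i%:R :> R by rewrite ltr0n.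
  have iNR : i%:R < N%:R :> R by rewrite ltr_nat.
  have s : 0 < sin (i%:R * (pi / N%:R)) :> R.
    apply: sin_gt0_pi; rewrite mulr_gt0// ?divr_gt0//=.
    by rewrite mulrCA gtr_pMr// ltr_pdivrMr// mul1r.
  rewrite cabsE expi_sqr_sub1 ?ltW// fmorph_eq0 gt_eqF//.
  by rewrite mulr_gt0.
- have t0 : 0 < pi / N%:R :> R by rewrite divr_gt0.
  rewrite expi_sqr_sub1.
    by rewrite -mulrA ler_pM2l//; exact: sin_le (ltW t0).
  apply: sin_ge0_pi; rewrite ltW//= ler_pdivrMr// ler_peMr ?ler1n//.
  exact: ltW.
Qed.

(** * Orthogonality relations for the roots of [-1] *)

Section PowerSums.
Variables (N : nat) (z : R[i]).
Hypothesis N0 : (0 < N)%N.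
Hypothesis zN : z ^+ N = -1.
Hypothesis z1 : cabs z = 1.
Hypothesis zi : forall i, (0 < i < N)%N -> (z ^+ 2) ^+ i != 1.

(** The odd powers of [z] run through the [N] roots of [-1], consecutive ones differing by the
    factor [z ^+ 2]. *)
Definition rt j := z ^+ (2 * j).+1.

Lemma rtN j : rt j ^+ N = -1.
Proof. by rewrite /rt exprAC zN exprS exprM sqrrN expr1n expr1n mulr1. Qed.

Lemma cabs_rt j : cabs (rt j) = 1.
Proof. by rewrite cabsX z1 expr1n. Qed.

Lemma rtS j : rt j.+1 = z ^+ 2 * rt j.
Proof. by rewrite /rt -exprD mulnS. Qed.

Lemma zz2N : (z ^+ 2) ^+ N = 1.
Proof. by rewrite exprAC zN sqrrN expr1n. Qed.

Lemma rt_periodic j : rt (j + N) = rt j.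
Proof. by rewrite /rt mulnDr -addSn exprD [_ ^+ (2 * N)]exprM zz2N mulr1. Qed.

(** For [m] other than [N] the sum is [z ^+ m] times a full geometric sum of the nontrivial [N]-th
    root of unity [(z ^+ 2) ^+ m]. *)
Lemma sum_rtX m : (0 < m < N.*2)%N ->
  \sum_(j < N) rt j ^+ m = if m == N then - N%:R else 0.
Proof.
move=> /andP[m0 m2]; case: eqVneq => [->|mN].
  under eq_bigr do rewrite rtN.
  by rewrite sumr_const card_ord mulNrn.
have z2m : (z ^+ 2) ^+ m != 1.
  have [lt|ge] := ltnP m N; first by apply: zi; rewrite m0.
  rewrite -(subnK ge) exprD zz2N mulr1; apply: zi.
  by rewrite subn_gt0 ltn_neqAle eq_sym mN ge /= ltn_subLR// addnn.
under eq_bigr do rewrite /rt exprAC exprS exprM [z ^+ m ^+ 2]exprAC.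
rewrite -mulr_sumr; apply/eqP; rewrite mulf_eq0; apply/orP; right.
have := subrX1 ((z ^+ 2) ^+ m) N.
rewrite [_ ^+ N](_ : _ = 1); last by rewrite (exprAC (z ^+ 2)) zz2N expr1n.
by rewrite subrr => /esym/eqP; rewrite mulf_eq0 subr_eq0 (negbTE z2m).
Qed.

Lemma rt_neq1 j : 1 - rt j != 0.
Proof.
rewrite subr_eq0; apply/eqP => h; have := rtN j; rewrite -h expr1n => /eqP.
by rewrite -addr_eq0 -mulr2n pnatr_eq0.
Qed.

(* On the unit circle |1 - w|^2 = - (1 - w)^2 / w, and 2 / (1 - w) is the
   geometric sum of the powers of w when w ^+ N = -1. *)
Lemma inv_sqr_rt j : ((cabs (1 - rt j) ^- 2)%:C = - (4^-1) *
  \sum_(k < N) \sum_(l < N) rt j ^+ (1 + k + l) :> R[i])%C.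
Proof.
set w := rt j; have w1 := rt_neq1 j; rewrite -/w in w1.
have w0 : w != 0 by apply: contraTneq isT => w0; have := cabs_rt j; rewrite -/w w0 /cabs normr0 /= => /eqP; rewrite eq_sym oner_eq0.
have geo : \sum_(k < N) w ^+ k = 2 / (1 - w).
  apply: (mulfI w1); rewrite mulrCA mulfV// mulr1.
  have := subrX1 w N; rewrite rtN => /(congr1 -%R); rewrite -mulNr !opprB => <-.
  by rewrite opprK.
have -> : \sum_(k < N) \sum_(l < N) w ^+ (1 + k + l) = w * (2 / (1 - w)) ^+ 2.
  rewrite -geo expr2 big_distrlr /= mulr_sumr; apply: eq_bigr => k _.
  by rewrite mulr_sumr; apply: eq_bigr => l _; rewrite !exprD expr1 mulrA.
have cw : Num.conj w = w^-1.
  apply: (mulfI w0); rewrite mulfV// -normCK cabsE cabs_rt.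
  by rewrite expr1n.
have -> : ((cabs (1 - w) ^- 2)%:C = ((1 - w) * (1 - w^-1))^-1 :> R[i])%C.
  by rewrite fmorphV rmorphXn /= -cabsE normCK rmorphB rmorph1 /= cw.
field.
by rewrite w0 w1 -oppr_eq0 opprB w1.
Qed.

(** By [inv_sqr_rt] this is a sum of powers with exponents [1 + k + l] between 1 and [2 N - 1];
    orthogonality keeps only the exponent [N], reached by one [l] for each [k]. *)
Lemma sum_inv_sqr_rt : \sum_(j < N) cabs (1 - rt j) ^- 2 = N%:R ^+ 2 / 4.
Proof.
apply: (@complexI R); rewrite rmorph_sum /=.
under eq_bigr do rewrite inv_sqr_rt.
rewrite -mulr_sumr exchange_big /=.
under eq_bigr => k _.
  rewrite exchange_big /=.
  under eq_bigr => l _.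
    rewrite sum_rtX; last by rewrite addnC ltn_addl//=; have := ltn_ord k; have := ltn_ord l; lia.
    over.
  rewrite (bigD1 (rev_ord k)) //= (_ : _ == N) ?big1 ?addr0.
  - over.
  - move=> l; case: ifP => // /eqP kl /eqP[]; apply: val_inj => /=; lia.
  - by apply/eqP; have := ltn_ord k; lia.
rewrite sumr_const card_ord -[(_ * _)%C]/(_ * _) rmorphM fmorphV !rmorphXn !rmorph_nat.
by rewrite mulNrn -mulrnA natrM mulrNN mulrC.
Qed.

End PowerSums.
End RootsOfMinusOne.

(** * A Ritt-type bound from resolvents at the roots of [-1] *)

Section Ritt.
Variables (R : realType) (X : completeNormedModType R[i]).
Variables (T : X -> X) (G : R[i] -> X -> X) (n : nat) (p c : R).
Let N := n.*2.
Hypothesis n0 : (0 < n)%N.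
Hypothesis p0 : 0 <= p.
Hypothesis c0 : 0 <= c.
Hypothesis lT : linear_op T.
Hypothesis bT : opnorm_le T p.
Hypothesis bTN : opnorm_le (iter N T) p.
Hypothesis lG : forall w, w ^+ N = -1 -> linear_op (G w).
Hypothesis GK : forall w x, w ^+ N = -1 -> G w x - w *: T (G w x) = x.
Hypothesis KG : forall w x, w ^+ N = -1 -> G w (x - w *: T x) = x.
Hypothesis bG : forall w x, w ^+ N = -1 -> cabs w = 1 ->
  nrm (G w x) <= c / cabs (1 - w) * nrm x.
Hypothesis bTG : forall w, w ^+ N = -1 -> cabs w = 1 ->
  opnorm_le (fun x => G w x - T (G w x)) c.

(** [GK] and [KG] say that [G w] inverts [1 - w T], hence it commutes with [T]. *)
Lemma TGC w x : w ^+ N = -1 -> T (G w x) = G w (T x).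
Proof.
move=> wN; rewrite -[in RHS](GK x wN) (linB lT) (linZ lT) KG//.
Qed.

Lemma GGC w v x : w ^+ N = -1 -> v ^+ N = -1 -> G v (G w x) = G w (G v x).
Proof.
move=> wN vN; rewrite -[in RHS](GK x wN) (linB (lG vN)) (linZ (lG vN)).
by rewrite -TGC// KG.
Qed.

(** [1 - w T] telescopes the right-hand side to [x - w ^+ N T^N x], and [w ^+ N = -1]. *)
Lemma geometric_resolvent w x : w ^+ N = -1 ->
  G w (x + iter N T x) = \sum_(k < N) w ^+ k *: iter k T x.
Proof.
move=> wN; rewrite -[RHS](KG _ wN); congr (G w _).
rewrite (lin_sum lT) scaler_sumr -sumrB.
rewrite -[X in _ + X]opprK -[- iter N T x]scaleN1r -wN.
rewrite -(big_mkord xpredT (fun k => w ^+ k *: iter k T x - w *: T (w ^+ k *: iter k T x))) /=.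
rewrite (eq_bigr (fun k => - (w ^+ k.+1 *: iter k.+1 T x - w ^+ k *: iter k T x))); last first.
  by move=> k _; rewrite opprB (linZ lT) scalerA -exprS iterS.
by rewrite sumrN telescope_sumr// opprB expr0 scale1r.
Qed.

(** Each of the three resolvents is a product of two factors [1 - a T] applied to the common vector
    [v]. In the second difference the multiples of [v] cancel and [(e - 1) ^+ 2] factors out. *)
Lemma second_difference w e x : w ^+ N = -1 -> e ^+ N = 1 ->
  let v := G w (G (e * w) (G (e ^+ 2 * w) x)) in
  G (e ^+ 2 * w) x - G (e * w) x *+ 2 + G w x =
  (w * (e - 1) ^+ 2) *: (T v + (e * w) *: T (T v)).
Proof.
move=> wN eN v.
have w1N : (e * w) ^+ N = -1 by rewrite exprMn eN mul1r.
have w2N : (e ^+ 2 * w) ^+ N = -1 by rewrite exprMn exprAC eN expr1n mul1r.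
set w1 := e * w in v w1N *; set w2 := e ^+ 2 * w in v w2N *.
have two a b y : a ^+ N = -1 -> b ^+ N = -1 -> forall u, u = G a (G b y) ->
  y = u - (a + b) *: T u + (a * b) *: T (T u).
  move=> aN bN u ->; rewrite -{1}(GK y bN) -{1 2}(GK (G b y) aN).
  rewrite (linB lT) (linZ lT) scalerBr scalerA [b * a]mulrC scalerDl.
  by rewrite !opprD !opprK !addrA.
have e0 : G w x = v - (w1 + w2) *: T v + (w1 * w2) *: T (T v).
  by apply: two => //; rewrite /v (GGC _ w1N wN) (GGC _ w2N wN).
have e1 : G w1 x = v - (w + w2) *: T v + (w * w2) *: T (T v).
  by apply: two => //; rewrite /v (GGC _ w2N w1N).
have e2 : G w2 x = v - (w + w1) *: T v + (w * w1) *: T (T v).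
  by apply: two => //.
pose comb a b d := a *: v + b *: T v + d *: T (T v).
have combD a b d a' b' d' : comb a b d + comb a' b' d' = comb (a + a') (b + b') (d + d').
  by rewrite /comb !scalerDl addrACA; congr (_ + _); rewrite addrACA.
have combN a b d : - comb a b d = comb (- a) (- b) (- d).
  by rewrite /comb !scaleNr !opprD.
have combE s t : v - s *: T v + t *: T (T v) = comb 1 (- s) t.
  by rewrite /comb scale1r scaleNr.
rewrite e0 e1 e2 !combE mulr2n combD combN !combD.
rewrite [RHS](_ : _ = comb 0 (w * (e - 1) ^+ 2) (w * (e - 1) ^+ 2 * (e * w))); last first.
  by rewrite /comb scale0r add0r scalerDr scalerA.
by congr comb; rewrite /w1 /w2; ring.
Qed.

(** Summing [W ^+ n] times the resolvent over the roots extracts [T^n]. Two summations by parts gain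
    [|e - 1|^2 = O(1 / n^2)] and produce products of three resolvents. The factor [1 - T] tames one
    of them and the other two sum to [O(n^2)], so division by [N] leaves [O(1 / n)]. *)
Lemma ritt_bound x :
  nrm (iter n T x - iter n.+1 T x) <=
  (pi ^+ 2 * p * (1 + p) ^+ 2 * c ^+ 3) / n%:R * nrm x.
Proof.
have N0 : (0 < N)%N by rewrite double_gt0.
have [z [zN z1 zi ze]] := root_of_minus1 R N0.
pose e := z ^+ 2; pose W j := rt z j; pose x' := x + iter N T x.
have WN j : W j ^+ N = -1 by exact: rtN.
have W1 j : cabs (W j) = 1 by exact: cabs_rt.
have eN : e ^+ N = 1 by exact: zz2N.
have en : e ^+ n = -1 by rewrite -exprM mul2n.
have WS j : W j.+1 = e * W j by exact: rtS.
have WSn j : W j.+1 ^+ n = - W j ^+ n by rewrite WS exprMn en mulN1r.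
have per (V : zmodType) (f : nat -> V) : (forall j, f (j + N)%N = f j) ->
    \sum_(j < N) f j.+1 = \sum_(j < N) f j.
  move=> fN; apply: (addrI (f 0%N)).
  rewrite -(big_ord_recl N (fun j : 'I_N.+1 => f j)) big_ord_recr /=.
  by rewrite -[N in f N]add0n fN addrC.
pose g j := W j ^+ n *: G (W j) x'.
have Wper j : W (j + N)%N = W j by exact: rt_periodic.
have gper j : g (j + N)%N = g j by rewrite /g Wper.
(* In the expansion of the resolvents orthogonality selects the exponent [k + n = N], that is
   [k = n]. *)
have sum_g : \sum_(j < N) g j = - (N%:R *: iter n T x).
  under eq_bigr do rewrite /g geometric_resolvent// scaler_sumr.
  have nN : (n < N)%N by rewrite /N; lia.
  rewrite exchange_big /= (bigD1 (Ordinal nN))//= [X in _ + X]big1 ?addr0 => [|k kn].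
    under eq_bigr do rewrite scalerA -exprD.
    rewrite -scaler_suml sum_rtX//; last by rewrite /N; lia.
    by rewrite addnn eqxx scaleNr.
  under eq_bigr do rewrite scalerA -exprD.
  rewrite -scaler_suml sum_rtX//; last by have := ltn_ord k; rewrite /N; lia.
  case: eqP => [nk|_]; last by rewrite scale0r.
  by case/eqP: kn; apply: val_inj => /=; move: nk; rewrite /N; lia.
pose v j := G (W j) (G (W j.+1) (G (W j.+2) x')).
have W2 j : W j.+2 = e ^+ 2 * W j by rewrite !WS expr2 mulrA.
(* Since [W j.+1 ^+ n = - W j ^+ n], the second difference weighted by [W j ^+ n] is
   [g j.+2 + 2 g j.+1 + g j]: the signs agree, and the cyclic sum counts [g] four times. *)
have sum4 : (4 * N%:R) *: iter n T x = - \sum_(j < N)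
    W j ^+ n *: ((W j * (e - 1) ^+ 2) *: (T (v j) + W j.+1 *: T (T (v j)))).
  have -> : \sum_(j < N) W j ^+ n *:
      ((W j * (e - 1) ^+ 2) *: (T (v j) + W j.+1 *: T (T (v j)))) =
      \sum_(j < N) (g j.+2 + g j.+1 *+ 2 + g j).
    apply: eq_bigr => j _; rewrite /v W2 WS -second_difference// -W2 -WS.
    rewrite scalerDr scalerBr -scalerMnr /g.
    by rewrite [W j.+2 ^+ n]WSn !WSn opprK [in RHS]scaleNr mulNrn.
  rewrite !big_split /= (per _ (fun j => g j.+1)); last by move=> j; rewrite -addSn gper.
  rewrite !(per _ g)// sum_g -mulr2n -mulrS -mulrSr mulNrn opprK scalerMnl.
  by rewrite [in LHS]mulr_natl.
pose Q y := y - T y.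
have lQ : linear_op Q by move=> a y1 y2; rewrite /Q lT scalerBr opprD addrACA.
have QT y : Q (T y) = T (Q y) by rewrite /Q (linB lT).
pose r j := (cabs (1 - W j))^-1.
have r0 j : 0 <= r j by rewrite invr_ge0 cabs_ge0.
(* [1 - T] is spent on the outer resolvent, which then costs only [c]; the other two keep their
   singular factors. *)
have bQv j : nrm (Q (v j)) <= c ^+ 3 * (1 + p) * (r j.+1 * r j.+2) * nrm x.
  apply: (le_trans (bTG (WN j) (W1 j) _)).
  have b1 := bG (G (W j.+2) x') (WN j.+1) (W1 j.+1).
  have b2 := bG x' (WN j.+2) (W1 j.+2).
  have bx : nrm x' <= (1 + p) * nrm x.
    by rewrite mulrDl mul1r (le_trans (nrmD _ _))// lerD2l.
  rewrite (_ : _ * nrm x = c * (c * r j.+1 * (c * r j.+2 * ((1 + p) * nrm x)))); last by ring.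
  apply: ler_wpM2l => //; apply: (le_trans b1); apply: ler_wpM2l; first exact: (mulr_ge0 c0 (r0 j.+1)).
  by apply: (le_trans b2); apply: ler_wpM2l => //; exact: (mulr_ge0 c0 (r0 j.+2)).
(* The product is at most the mean of the squares, and shifts do not change cyclic sums. *)
have sumr : \sum_(j < N) r j.+1 * r j.+2 <= N%:R ^+ 2 / 4.
  have S2 : \sum_(j < N) r j ^+ 2 = N%:R ^+ 2 / 4.
    by rewrite -(sum_inv_sqr_rt N0 zN z1 zi); apply: eq_bigr => j _; rewrite exprVn.
  have rper j : r (j + N)%N = r j by rewrite /r Wper.
  have S3 : \sum_(j < N) (r j.+1 ^+ 2 + r j.+2 ^+ 2) / 2 = N%:R ^+ 2 / 4.
    rewrite -mulr_suml big_split /= (per _ (fun j => r j.+1 ^+ 2)); last by move=> j; rewrite -addSn rper.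
    rewrite !(per _ (fun j => r j ^+ 2)) ?S2; first by field.
    by move=> j; rewrite rper.
  rewrite -S3; apply: ler_sum => j _; have := sqr_ge0 (r j.+1 - r j.+2); nra.
have [E2 E2E] : {E2 | E2 = cabs (e - 1) ^+ 2} by exists (cabs (e - 1) ^+ 2).
have E20 : 0 <= E2 by rewrite E2E exprn_ge0 ?cabs_ge0.
have main : 4 * N%:R * nrm (Q (iter n T x)) <=
    E2 * (p + p * p) * (c ^+ 3 * (1 + p)) * (N%:R ^+ 2 / 4) * nrm x.
  have := congr1 (fun y => nrm (Q y)) sum4.
  rewrite (linZ lQ) nrmZ (linN lQ) nrmN (lin_sum lQ) cabsM.
  rewrite (_ : cabs 4 = 4); last first.
    by rewrite /cabs normr_nat -[4%:R in LHS](rmorph_nat (real_complex R)).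
  rewrite (_ : cabs N%:R = N%:R); last first.
    by rewrite /cabs normr_nat -[N%:R in LHS](rmorph_nat (real_complex R)).
  move=> ->; apply: (le_trans (nrm_sum _ _ _)).
  have K0 : 0 <= E2 * (p + p * p) * (c ^+ 3 * (1 + p)) * nrm x.
    by rewrite !mulr_ge0 ?exprn_ge0 ?cabs_ge0 ?nrm_ge0 ?addr_ge0 ?mulr_ge0.
  rewrite mulrAC; apply: (le_trans _ (ler_wpM2l K0 sumr)).
  rewrite mulr_sumr; apply: ler_sum => j _.
  rewrite !(linZ lQ) !nrmZ (cabsM (W j)) (cabsX (W j) n) (cabsX (e - 1) 2) -E2E !W1 expr1n !mul1r.
  rewrite (linD lQ) (linZ lQ) !QT.
  apply: (@le_trans _ _ (E2 * ((p + p * p) * nrm (Q (v j))))).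
    apply: ler_wpM2l; first exact: E20.
    apply: (le_trans (nrmD _ _)); rewrite nrmZ W1 mul1r mulrDl lerD//.
    by apply: (le_trans (bT _)); rewrite -mulrA ler_wpM2l.
  rewrite -!mulrA; apply: ler_wpM2l; first exact: E20.
  apply: ler_wpM2l; first by rewrite addr_ge0// mulr_ge0.
  apply: (le_trans (bQv j)); rewrite le_eqVlt; apply/orP; left; apply/eqP; ring.
rewrite iterS -/(Q _); set q := nrm (Q _) in main *.
have q0 : 0 <= q by exact: nrm_ge0.
have n1 : 0 < n%:R :> R by rewrite ltr0n.
have NE : N%:R = 2 * n%:R :> R by rewrite /N -mul2n natrM.
have e2 : E2 <= pi ^+ 2 / n%:R ^+ 2.
  have -> : pi ^+ 2 / n%:R ^+ 2 = (2 * pi / N%:R) ^+ 2 :> R.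
    by rewrite NE; field; rewrite gt_eqF.
  by rewrite E2E lerXn2r// ?nnegrE ?cabs_ge0// !mulr_ge0// ?pi_ge0// invr_ge0.
pose K := p * (1 + p) ^+ 2 * c ^+ 3 * nrm x.
have K0 : 0 <= K by rewrite !mulr_ge0 ?exprn_ge0 ?addr_ge0 ?nrm_ge0.
have : 8 * n%:R * q <= pi ^+ 2 * K.
  rewrite (_ : 8 * n%:R = 4 * N%:R); last by rewrite NE; ring.
  apply: (le_trans main).
  rewrite (_ : _ * nrm x = E2 * (n%:R ^+ 2 * K)); last by rewrite NE /K; field.
  apply: (le_trans (ler_wpM2r _ e2)); first by rewrite mulr_ge0 ?exprn_ge0 ?ler0n.
  by rewrite mulrA divfK// gt_eqF// exprn_gt0.
move=> h; rewrite (_ : _ / _ * _ = pi ^+ 2 * K / n%:R); last by rewrite /K; ring.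
rewrite ler_pdivlMr// mulrC; apply: (le_trans _ h).
by have := mulr_ge0 (ltW n1) q0; lra.
Qed.
End Ritt.

(** * Uniform smoothing of the frozen semigroups *)

Section Smoothing.
Variables (R : realType) (X : completeNormedModType R[i]).
Variables (D : set X) (A : X -> X) (S : R -> X -> X) (w M0 : R).
Hypothesis lA : linear_on D A.
Hypothesis gS : generates_C0 D A S.
Hypothesis w0 : 0 <= w.
Hypothesis bS : forall tau, 0 <= tau -> opnorm_le (S tau) (expR (w * tau)).

Lemma real_complex_cvg0 : (fun h : R => h%:C : R[i]^o) @ 0^'+ --> (0 : R[i]^o)^'.
Proof.
move=> P /nbhs_ballP[e /= e0 he].
apply/nbhs_rightP; move: e0; rewrite ltcE /= => /andP[/eqP ei er].
exists (complex.Re e) => // h h0; rewrite add0r => hd; apply: he.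
  rewrite /ball /= sub0r normrN cabsE cabs_real gtr0_norm// ltcE /=.
  by rewrite ei eqxx.
by rewrite /= fmorph_eq0 gt_eqF.
Qed.

(** The complex derivative of the extension, restricted to real increments, is a right derivative of
    the orbit at [tau], that is of the orbit of [S tau x] at 0. *)
Lemma analytic_dom : analytic_semigroup S -> forall tau x, 0 < tau -> D (S tau x).
Proof.
move=> [k [Se [k0 [_ _ dSe SeS _]]]] tau x t0.
have sec : csector k tau%:C by split=> //=; rewrite normr0 mulr_gt0.
have /cvg_ex[v hv] := dSe x _ sec.
have hv' : has_rderiv (fun s => S s x) tau v.
  have := cvg_comp _ _ real_complex_cvg0 hv.
  apply: cvg_trans; apply: near_eq_cvg; apply/nbhs_rightP; exists 1 => // h h0 _ /=.
  rewrite scaler1 -rmorphD /= SeS//; last by rewrite addr_gt0.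
  by rewrite SeS// [h + tau]addrC.
move/has_rderivP : hv' => rv.
have [//] : D (S tau x) /\ A (S tau x) = v.
apply: (sg_gen gS) => e /rv[d d0 h]; exists d => // s s0 /(h _ s0).
by rewrite [tau + s]addrC (sgD gS) ?(ltW s0) ?(ltW t0).
Qed.

Hypothesis smooth : forall tau x, 0 < tau -> D (S tau x).
Hypothesis M01 : 1 <= M0.
Variable Rf : R[i] -> X -> X.
Hypothesis rf : forall z, 0 <= complex.Re z -> is_resolvent D A z (Rf z).
Hypothesis bRf : forall z, 0 <= complex.Re z -> opnorm_le (Rf z) (M0 / (cabs z + 1)).

(** * Backward Euler approximation of a frozen semigroup *)

Section Step.
Variable l : R.
Hypothesis l0 : 0 < l.
Hypothesis lw : 4 * w <= l.

(** The backward Euler step [(1 - A / l)^-1] of length [1 / l]; [A] applied to it is the Yosida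
    approximation of [A]. *)
Definition yosida x := l%:C *: Rf l%:C x.

Let rl : is_resolvent D A l%:C (Rf l%:C).
Proof. by apply: rf; exact: ltW. Qed.

Lemma yosida_lin : linear_op yosida.
Proof.
case: rl => [[h _] _ _] a x y.
by rewrite /yosida h scalerDr !scalerA [_ * a]mulrC.
Qed.

Lemma yosida_dom x : D (yosida x).
Proof. by case: rl => _ /(_ x)[h _] _; exact: (lonZD lA). Qed.

Lemma yosida_gen x : A (yosida x) = l%:C *: (yosida x - x).
Proof.
case: rl => _ /(_ x)[+ +] _; rewrite /yosida; move: (Rf l%:C x) => q h <-.
by rewrite (lonZ lA)// opprB [_ + (_ - _)]addrC subrK.
Qed.

Lemma yosida_genC x : D x -> A (yosida x) = yosida (A x).
Proof.
move=> Dx; rewrite yosida_gen /yosida; congr (_ *: _).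
case: rl => [[h _] _ /(_ x Dx)]; rewrite (linB h) (linZ h) => e.
by rewrite -{2}e opprB addrC subrK.
Qed.

(** With [u = w / l <= 1/4], dissipativity gives the bound [1 / (1 - 2 u)], which is at most
    [1 + 4 u]. *)
Lemma yosida_bound : opnorm_le yosida (expR (4 * w / l)).
Proof.
move=> x; case: rl => _ /(_ x)[h e] _; rewrite /yosida nrmZr gtr0_norm//.
have := sg_dissipative gS w0 bS l h; rewrite e.
set q := nrm (Rf _ _) => H; have q0 : 0 <= q by exact: nrm_ge0.
have E := expR_ge1Dx (4 * w / l).
apply: (le_trans _ (ler_wpM2r (nrm_ge0 x) E)).
have u0 : 0 <= w / l by rewrite divr_ge0// ltW.
have u1 : w / l <= 4^-1 by rewrite ler_pdivrMr// mulrC ler_pdivlMr// mulrC.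
have wE : w = w / l * l by rewrite divfK// gt_eqF.
rewrite -mulrA; set u := w / l in u0 u1 wE *.
clearbody u; clearbody q.
have {}H : (1 - 2 * u) * (l * q) <= nrm x.
  by rewrite (_ : _ * (l * q) = (l - 2 * w) * q)//; rewrite wE; ring.
have lq : 0 <= l * q by rewrite mulr_ge0// ltW.
have : (1 + 4 * u) * ((1 - 2 * u) * (l * q)) <= (1 + 4 * u) * nrm x.
  by rewrite ler_wpM2l//; lra.
have : 0 <= (2 * u * (1 - 4 * u)) * (l * q).
  by rewrite mulr_ge0// mulr_ge0//; lra.
lra.
Qed.

Lemma yosida_iter_bound k : opnorm_le (iter k yosida) (expR (4 * w / l * k%:R)).
Proof.
elim: k => [|k IH] x; first by rewrite mulr0 expR0 mul1r.
rewrite iterS; apply: (le_trans (yosida_bound _)).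
rewrite -[k.+1%:R]natr1 mulrDr mulr1 [_ + 4 * w / l]addrC expRD -[_ * nrm x]mulrA.
by apply: ler_wpM2l; rewrite ?expR_ge0.
Qed.

Lemma yosida_iter_genC k x : D x -> D (iter k yosida x) /\
  A (iter k yosida x) = iter k yosida (A x).
Proof.
move=> Dx; elim: k => [//|k [Dk Ak]]; rewrite iterS; split; first exact: yosida_dom.
by rewrite yosida_genC// Ak.
Qed.

(** Both operators agree with [1 + A / l] up to order [l^-2]: the Euler step by an exact identity,
    the semigroup by [sg_taylor]. *)
Lemma yosida_sub_sg x : D x -> D (A x) ->
  nrm (yosida x - S l^-1 x) <= 2 * expR (4 * w / l) * l^-1 ^+ 2 * nrm (A (A x)).
Proof.
move=> Dx DAx; have h0 : 0 < l^-1 by rewrite invr_gt0.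
have lC : l%:C != 0 by rewrite fmorph_eq0 gt_eqF.
have id y : yosida y = y + (l^-1)%:C *: A (yosida y).
  by rewrite yosida_gen scalerA fmorphV mulVf// scale1r addrC subrK.
have Y : yosida x - (x + (l^-1)%:C *: A x) = ((l^-1)%:C * (l^-1)%:C) *: yosida (A (A x)).
  rewrite {1}id yosida_genC// opprD addrACA subrr add0r -scalerBr {1}id.
  by rewrite yosida_genC// [A x + _]addrC addrK scalerA.
apply: (le_trans (nrm_tri (x + (l^-1)%:C *: A x) _ _)).
rewrite {}Y -rmorphM nrmZr ger0_norm; last by rewrite mulr_ge0// ltW.
have t := sg_taylor lA gS w0 bS (ltW h0) Dx DAx.
have e4 : expR (w * l^-1) <= expR (4 * w / l).
  by rewrite ler_expR -mulrA; have : 0 <= w / l by [rewrite divr_ge0// ltW]; lra.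
have n0 := nrm_ge0 (A (A x)).
have hh : 0 <= l^-1 * l^-1 by rewrite mulr_ge0// ltW.
have b1 := ler_wpM2l hh (yosida_bound (A (A x))).
have b2 : expR (w * l^-1) * nrm (A (A x)) * l^-1 ^+ 2 <= expR (4 * w / l) * nrm (A (A x)) * l^-1 ^+ 2.
  by rewrite expr2 ler_wpM2r// ler_wpM2r.
apply: (le_trans (lerD b1 (le_trans t b2))).
by rewrite le_eqVlt; apply/orP; left; apply/eqP; ring.
Qed.

(** Consistency and stability: one-step errors along the semigroup orbit, on which [A] commutes with
    [S], are propagated by powers of [yosida]. *)
Lemma yosida_iter_sub_sg k x : D x -> D (A x) ->
  nrm (iter k yosida x - S (k%:R / l) x) <=
  2 * k%:R * l^-1 ^+ 2 * expR (4 * w / l * k%:R) * nrm (A (A x)).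
Proof.
move=> Dx DAx; elim: k => [|k IH].
  by rewrite /= mul0r (sg0 gS) subrr nrm0 mulr0 !mul0r.
have k0 : 0 <= k%:R / l by rewrite divr_ge0// ltW.
have h0 : 0 < l^-1 by rewrite invr_gt0.
have [Dk Ak] := sg_dom gS bS k0 Dx.
have [DAk AAk] := sg_dom gS bS k0 DAx.
have -> : S (k.+1%:R / l) x = S l^-1 (S (k%:R / l) x).
  by rewrite -(sgD gS) ?(ltW h0)// -[k.+1%:R]natr1 mulrDl mul1r addrC.
rewrite -[k.+1%:R]natr1.
apply: (le_trans (nrm_tri (yosida (S (k%:R / l) x)) _ _)).
rewrite iterS -(linB yosida_lin).
have b1 := le_trans (yosida_bound (iter k yosida x - S (k%:R / l) x)) (ler_wpM2l (expR_ge0 _) IH).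
have b2 : nrm (yosida (S (k%:R / l) x) - S l^-1 (S (k%:R / l) x)) <=
   2 * expR (4 * w / l) * l^-1 ^+ 2 * (expR (4 * w / l * k%:R) * nrm (A (A x))).
  apply: (le_trans (yosida_sub_sg Dk _)); first by rewrite Ak.
  apply: ler_wpM2l; first by rewrite !mulr_ge0 ?exprn_ge0 ?expR_ge0 ?ltW.
  rewrite Ak AAk; apply: (le_trans (bS k0 _)); rewrite ler_wpM2r ?nrm_ge0//.
  rewrite ler_expR (_ : 4 * w / l * k%:R = 4 * (w * (k%:R / l))); last by ring.
  by have := mulr_ge0 w0 k0; lra.
apply: (le_trans (lerD b1 b2)).
rewrite (_ : 4 * w / l * (k%:R + 1) = 4 * w / l + 4 * w / l * k%:R) ?expRD; last by ring.
by rewrite le_eqVlt; apply/orP; left; apply/eqP; ring.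
Qed.

End Step.
Lemma unimodular_of_root N (v : R[i]) : (0 < N)%N -> v ^+ N = -1 -> cabs v = 1.
Proof.
move=> N0 vN; apply/eqP; rewrite -(@pexpr_eq1 _ _ N)// ?cabs_ge0// -cabsX vN.
by rewrite cabsN cabs1.
Qed.

Lemma Re_le_cabs (z : R[i]) : complex.Re z <= cabs z.
Proof.
have := normc_ge_Re z; rewrite cabsE lecR; apply: le_trans; exact: ler_norm.
Qed.

Definition ritt_const (p : R) := pi ^+ 2 * p * (1 + p) ^+ 2 * (2 + M0) ^+ 3.

(** For [T = l R(l, A)] the inverse of [1 - v T] is [1 + l v R(l (1 - v), A)], and for [|v| = 1] the
    point [l (1 - v)] lies in the closed right half-plane, where the resolvent bound holds. *)
Lemma yosida_ritt (l : R) n x : 0 < l -> 4 * w <= l -> (0 < n)%N ->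
  nrm (iter n (yosida l) x - iter n.+1 (yosida l) x) <=
  ritt_const (expR (4 * w / l * n.*2%:R)) / n%:R * nrm x.
Proof.
move=> l0 lw n0; have N0 : (0 < n.*2)%N by rewrite double_gt0.
have M00 : 0 <= M0 by apply: le_trans M01.
pose z v : R[i] := l%:C * (1 - v).
have zRe v : v ^+ n.*2 = -1 -> 0 <= complex.Re (z v).
  move=> vN; have v1 := unimodular_of_root N0 vN.
  have := Re_le_cabs v; rewrite v1; case: (v) => a b /= h; simpc.
  by rewrite mulr_ge0 ?(ltW l0)// subr_ge0.
have lz v : l%:C - z v = l%:C * v by rewrite /z mulrBr mulr1 opprB addrC subrK.
have zabs v : cabs (z v) = l * cabs (1 - v) by rewrite cabsM cabs_real gtr0_norm.
pose G v y := y + (l%:C * v) *: Rf (z v) y.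
have Tl := yosida_lin l0.
have lC0 : 0 <= complex.Re l%:C by exact: ltW.
(* the resolvent of T at 1/v is a resolvent of A at l (1 - v) *)
have TG v y : v ^+ n.*2 = -1 -> yosida l (G v y) = l%:C *: Rf (z v) y.
  move=> /zRe/rf[_ /(_ y)[Dr er] _].
  have [_ _ /(_ _ Dr) <-] := rf lC0.
  rewrite /yosida /G -{1}er; congr (_ *: Rf _ _).
  by rewrite -lz scalerBl addrAC [_ + (_ - _)]addrC subrK.
have R1 v y : v ^+ n.*2 = -1 -> nrm (z v *: Rf (z v) y) <= M0 * nrm y.
  move=> /zRe zr; have z0 := cabs_ge0 (z v).
  rewrite nrmZ; apply: (le_trans (ler_wpM2l z0 (bRf zr y))).
  rewrite mulrA ler_wpM2r ?nrm_ge0// mulrCA ger_pMr ?(lt_le_trans ltr01)//.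
  by rewrite ler_pdivrMr ?mul1r ?lerDl// ltr_wpDl.
have v1N (v : R[i]) : v ^+ n.*2 = -1 -> 0 < cabs (1 - v).
  move=> vN; apply: cabs_gt0; rewrite subr_eq0; apply: contra_eq_neq vN => <-.
  by rewrite expr1n -addr_eq0 -mulr2n pnatr_eq0.
apply: (@ritt_bound R X (yosida l) G) => //.
- exact: addr_ge0.
- move=> y; apply: (le_trans (yosida_bound l0 lw _)).
  rewrite ler_wpM2r ?nrm_ge0// ler_expR ler_peMr ?ler1n//.
  by rewrite !mulr_ge0// invr_ge0 ltW.
- exact: yosida_iter_bound.
- move=> v /zRe/rf[[lR _] _ _] a y1 y2.
  by rewrite /G lR !scalerDr !scalerA [_ * a]mulrC addrACA.
- by move=> v y vN; rewrite TG// scalerA [v * _]mulrC /G addrK.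
- move=> v y vN; have [_ /(_ y)[Dq eq] _] := rf lC0.
  have qe : Rf (z v) (y - v *: yosida l y) = Rf l%:C y.
    have [_ _ /(_ _ Dq) <-] := rf (zRe v vN); congr (Rf _ _).
    rewrite /yosida -{1}eq scalerA [v * _]mulrC addrAC -scalerBl.
    by rewrite -lz opprB [_ + (_ - _)]addrC subrK.
  by rewrite /G qe /yosida scalerA [v * _]mulrC subrK.
(* [G v] is bounded by [1 + M0 / |1 - v|], and [|1 - v| <= 2] absorbs the 1. *)
- move=> v y vN v1; have c1 := v1N v vN.
  have h : cabs (1 - v) * (l * nrm (Rf (z v) y)) <= M0 * nrm y.
    by have := R1 v y vN; rewrite nrmZ zabs mulrCA mulrA.
  have c2 : cabs (1 - v) <= 2.
    by apply: (le_trans (cabsD _ _)); rewrite cabsN v1 cabs1.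
  rewrite mulrAC ler_pdivlMr//.
  have : nrm (G v y) <= nrm y + l * nrm (Rf (z v) y).
    apply: (le_trans (nrmD _ _)); rewrite [nrm (_ *: _)]nrmZ cabsM v1 mulr1 cabs_real.
    by rewrite gtr0_norm.
  move=> /(ler_wpM2r (ltW c1)) h2; apply: (le_trans h2).
  by have := ler_wpM2r (nrm_ge0 y) c2; lra.
(* Here [(1 - T) G v = 1 - z R(z, A)] with [z = l (1 - v)], which is bounded by [1 + M0]. *)
- move=> v vN v1 y; rewrite TG// /G -addrA -scalerBl -[_ - l%:C]opprK opprB.
  rewrite (_ : l%:C - l%:C * v = z v); last by rewrite /z mulrBr mulr1.
  rewrite scaleNr; apply: (le_trans (nrmB _ _)); have := R1 v y vN.
  by have := nrm_ge0 y; nra.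
Qed.

(** With [l = n / tau] and [T] the Euler step, [T^(n+1) A x = l (T^(n+1) x - T^n x)] is bounded by
    [yosida_ritt]. As [n] grows, [T^(n+1) A x] approaches [T^n A x], again by [yosida_ritt], and
    [T^n A x] approaches [S tau (A x)]. *)
Lemma sg_gen_bound_core tau x : 0 < tau -> D x -> D (A x) -> D (A (A x)) ->
  nrm (S tau (A x)) <= ritt_const (expR (8 * w * tau)) / tau * nrm x.
Proof.
move=> t0 Dx DAx DAAx; set p := expR _; set K := ritt_const p.
have tn0 : tau != 0 by rewrite gt_eqF.
have M00 : 0 <= M0 by apply: le_trans M01.
have K0 : 0 <= K.
  by rewrite /K /ritt_const !mulr_ge0 ?exprn_ge0 ?pi_ge0 ?addr_ge0 ?expR_ge0.
have p0 : 0 <= p by exact: expR_ge0.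
set B := A x in DAx DAAx *.
(* [c / n] bounds the sum of the two vanishing errors, the Euler error and the Ritt difference at
   [B]. *)
pose c := 2 * tau ^+ 2 * p * nrm (A (A B)) + K * nrm B.
have c0 : 0 <= c.
  rewrite /c; apply: addr_ge0; last exact: (mulr_ge0 K0 (nrm_ge0 B)).
  rewrite !mulr_ge0 ?exprn_ge0 ?nrm_ge0 ?(ltW t0)//.
apply/ler_addgt0Pl => e e0.
pose b := Num.max (4 * w * tau) (c / e) + 1.
pose n := (Num.truncn b).+1.
have bn : b <= n%:R by rewrite ltW// truncnS_gt.
have n1 : 4 * w * tau <= n%:R /\ c / e <= n%:R.
  have := le_max (4 * w * tau) (4 * w * tau) (c / e).
  have := le_max (c / e) (4 * w * tau) (c / e).
  by rewrite !lexx orbT /= => h1 h2; split; rewrite /b in bn; lra.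
case: n1 => n1 n2.
have nn : 0 < n%:R :> R by rewrite ltr0n.
pose l := n%:R / tau.
have l0 : 0 < l by rewrite divr_gt0.
have lw : 4 * w <= l by rewrite ler_pdivlMr.
have e8 : 4 * w / l * n.*2%:R = 8 * w * tau.
  rewrite /l -mul2n natrM; field; rewrite tn0/= gt_eqF//.
have e4 : expR (4 * w / l * n%:R) <= p.
  rewrite ler_expR (_ : _ * n%:R = 4 * w * tau).
    by have := mulr_ge0 w0 (ltW t0); lra.
  by rewrite /l; field; rewrite tn0/= gt_eqF.
have nl : n%:R / l = tau by rewrite /l; field; rewrite tn0/= gt_eqF.
have r1 := yosida_ritt B l0 lw (ltn0Sn _ : (0 < n)%N).
have r2 := yosida_ritt x l0 lw (ltn0Sn _ : (0 < n)%N).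
rewrite e8 -/p -/K in r1 r2.
have s1 := yosida_iter_sub_sg l0 lw n DAx DAAx; rewrite nl in s1.
have gx : nrm (iter n.+1 (yosida l) B) <= K / tau * nrm x.
  have [_ <-] := yosida_iter_genC l0 n.+1 Dx.
  rewrite iterS yosida_gen// nrmZr gtr0_norm// -iterS nrmBC.
  apply: (le_trans (ler_wpM2l (ltW l0) r2)).
  rewrite le_eqVlt; apply/orP; left; apply/eqP; rewrite /l; field.
  by rewrite tn0/= gt_eqF.
have s2 : nrm (iter n (yosida l) B - S tau B) <= 2 * tau ^+ 2 * p * nrm (A (A B)) / n%:R.
  apply: (le_trans s1).
  have -> : 2 * tau ^+ 2 * p * nrm (A (A B)) / n%:R =
    2 * n%:R * l^-1 ^+ 2 * p * nrm (A (A B)).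
    by rewrite /l; field; rewrite tn0/= gt_eqF.
  rewrite ler_wpM2r ?nrm_ge0// ler_wpM2l//.
  by rewrite !mulr_ge0 ?exprn_ge0 ?invr_ge0 ?ltW.
have ce : c / n%:R <= e by rewrite ler_pdivrMr// mulrC -ler_pdivrMr.
rewrite -[S tau B](subrK (iter n (yosida l) B)) -[X in _ + X](subrK (iter n.+1 (yosida l) B)).
apply: (le_trans (nrmD _ _)); rewrite nrmBC.
have := nrmD (iter n (yosida l) B - iter n.+1 (yosida l) B) (iter n.+1 (yosida l) B).
by move: ce; rewrite /c mulrDl => ce hh; lra.
Qed.

Lemma sg_gen_pos s t x : 0 < s -> 0 < t -> D (A (S (s + t) x)) /\ A (S (s + t) x) = S s (A (S t x)).
Proof.
move=> s0 t0; rewrite (sgD gS) ?ltW//.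
by have [_ ->] := sg_dom gS bS (ltW s0) (smooth x t0); split=> //; exact: smooth.
Qed.

Definition smooth_const (k : R) := 2 * ritt_const (expR (8 * w * k)) * expR (w * k).

(** Half of the time makes the data smooth enough for [sg_gen_bound_core], the other half gives the
    decay; hence the 2 and the [expR (w * k)] in [smooth_const]. *)
Lemma sg_gen_bound tau k x : 0 < tau -> tau <= k ->
  nrm (A (S tau x)) <= smooth_const k / tau * nrm x.
Proof.
move=> t0 tk; pose s := tau / 2; have s0 : 0 < s by rewrite divr_gt0.
have k0 : 0 < k := lt_le_trans t0 tk.
have M00 : 0 <= M0 by apply: le_trans M01.
set z := S s x.
have Dz : D z by exact: smooth.
(* Three successive smoothing steps put [z] in the domain of the third power of [A]. *)
have s3 : 0 < s / 3 by rewrite divr_gt0.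
have se : s = s / 3 + (s / 3 + s / 3) by field.
have s33 : 0 < s / 3 + s / 3 by rewrite addr_gt0.
have [DAz Az] := sg_gen_pos x s3 s33; rewrite -se -/z in DAz Az.
have [DAz' _] := sg_gen_pos x s3 s3.
have [_ AAz] := sg_dom gS bS (ltW s3) DAz'; rewrite -Az in AAz.
have DAAz : D (A (A z)) by rewrite AAz; exact: smooth.
have -> : A (S tau x) = S s (A z).
  by have [_ <-] := sg_gen_pos x s0 s0; rewrite -splitr.
apply: (le_trans (sg_gen_bound_core s0 Dz DAz DAAz)).
have sk : s <= k by rewrite /s; lra.
have zx : nrm z <= expR (w * k) * nrm x by apply: (sg_bound w0 bS) => //; exact: ltW.
have mono : ritt_const (expR (8 * w * s)) <= ritt_const (expR (8 * w * k)).
  have ee : expR (8 * w * s) <= expR (8 * w * k) by rewrite ler_expR ler_wpM2l// mulr_ge0.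
  have e0 := expR_ge0 (8 * w * s).
  rewrite /ritt_const ler_wpM2r ?exprn_ge0 ?addr_ge0// ler_pM ?mulr_ge0 ?exprn_ge0 ?pi_ge0 ?addr_ge0//.
    by rewrite ler_wpM2l ?exprn_ge0 ?pi_ge0.
  by rewrite lerXn2r ?nnegrE ?addr_ge0 ?expR_ge0// lerD2l.
have K0 p : 0 <= p -> 0 <= ritt_const p.
  by move=> p0; rewrite /ritt_const !mulr_ge0 ?exprn_ge0 ?pi_ge0 ?addr_ge0.
have -> : smooth_const k / tau * nrm x = ritt_const (expR (8 * w * k)) / s * (expR (w * k) * nrm x).
  by rewrite /smooth_const /s; field; rewrite gt_eqF.
apply: ler_pM => //; [|exact: nrm_ge0|].
  by rewrite divr_ge0 ?K0 ?expR_ge0 ?(ltW s0).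
by rewrite ler_wpM2r// invr_ge0 ltW.
Qed.

End Smoothing.

(** * Dyadic refinement of the frozen propagators *)

Section Splitting.
Variables (R : realType) (X : completeNormedModType R[i]).
Variables (D : set X) (A : R -> X -> X) (S : R -> R -> X -> X).
Variables (w alpha beta C k Ks : R).
Hypothesis lA : forall t, linear_on D (A t).
Hypothesis gS : forall t, generates_C0 D (A t) (S t).
Hypothesis w0 : 0 <= w.
Hypothesis bS : forall t tau, 0 <= tau -> opnorm_le (S t tau) (expR (w * tau)).
Hypothesis smooth : forall t tau x, 0 < tau -> D (S t tau x).
Hypothesis Ks0 : 0 <= Ks.
Hypothesis bAS : forall t tau x, 0 < tau -> tau <= k ->
  nrm (A t (S t tau x)) <= Ks / tau * nrm x.
Hypothesis C0 : 0 <= C.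
Hypothesis a01 : 0 <= alpha <= 1.
Hypothesis ab : alpha < beta.
Hypothesis HA : forall x s tau t, D x -> s <= tau -> tau <= t ->
  nrm (A t x - A s x)
    <= C * `|t - s| `^ beta * nrm (A tau x) `^ alpha * nrm x `^ (1 - alpha).
Let g := beta - alpha.

Let g0 : 0 < g. Proof. by rewrite subr_gt0. Qed.
Let b0 : 0 < beta. Proof. by case/andP: a01 => h _; exact: le_lt_trans ab. Qed.

Lemma powR_interp (m : R) : 0 <= m -> m `^ alpha * m `^ (1 - alpha) = m.
Proof.
move=> m0; rewrite -powRD; first by rewrite addrC subrK powRr1.
by rewrite addrC subrK oner_eq0.
Qed.

Lemma interp_le (m n c d : R) : 0 <= m -> 0 <= n -> m <= c -> n <= d ->
  m `^ alpha * n `^ (1 - alpha) <= c `^ alpha * d `^ (1 - alpha).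
Proof.
case/andP: a01 => a0 a1 m0 n0 mc nd.
apply: ler_pM; rewrite ?powR_ge0//; apply: ge0_ler_powR => //;
  rewrite ?nnegrE ?subr_ge0//; [exact: le_trans mc|exact: le_trans nd].
Qed.

Lemma contpt_sub (P Q : set R) (u : R -> X) t : P `<=` Q -> contpt Q u t -> contpt P u t.
Proof. by move=> PQ h e /h[d d0 hd]; exists d => // s /PQ; exact: hd. Qed.

Lemma sg_rder t x s : 0 <= s -> D (S t s x) ->
  rder (fun r => S t r x) s (A t (S t s x)).
Proof.
move=> s0 /(sg_der (gS t)) h e /h[d d0 hd]; exists d => // r r0 /(hd _ r0).
by rewrite -(sgD (gS t)) ?(ltW r0)// [r + s]addrC.
Qed.

Definition half_const := expR (w * k) * C * (Ks + expR (w * k)).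

(** With [r = h / 2], the defect [(A s - A (s + r)) (S s (t + r) x)] is estimated by (H) at
    [tau = s]. The half step already done gives [t + r >= r], so the smoothing bound costs only [r]
    to the power [- alpha]. *)
Lemma half_step s h x : 0 < h -> h <= k ->
  nrm (S s h x - S (s + h / 2) (h / 2) (S s (h / 2) x)) <=
  half_const * (h * h `^ g) * nrm x.
Proof.
move=> h0 hk; pose r := h / 2; have r0 : 0 < r by rewrite divr_gt0.
have hE : h = r + r by rewrite /r -splitr.
(* [M] bounds the orbit and [M / r] its image under [A s], so the interpolated product is [M] times
   a power of [r]. *)
pose M := (Ks + expR (w * k)) * nrm x.
have M0 : 0 <= M by rewrite mulr_ge0 ?addr_ge0 ?expR_ge0 ?nrm_ge0.
rewrite -/r; pose y := S s r x; pose v t := S s t y.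
pose B := C * r `^ beta * ((M / r) `^ alpha * M `^ (1 - alpha)).
have BE : B = C * M * r `^ g.
  have ra : r^-1 `^ alpha = r `^ (- alpha).
    by rewrite -powR_inv1 ?(ltW r0)// -powRrM mulN1r.
  have rg : r `^ g = r `^ beta * r `^ (- alpha).
    by rewrite -powRD// gt_eqF// implybT.
  rewrite /B powRM ?invr_ge0 ?(ltW r0)// ra rg -[in RHS](powR_interp M0).
  by ring.
have B0 : 0 <= B by rewrite BE; apply: mulr_ge0 (powR_ge0 _ _); exact: mulr_ge0.
have ys t : 0 <= t -> v t = S s (t + r) x by move=> t0; rewrite (sgD (gS s)) ?(ltW r0).
have cmp := @sg_compare R X D (A (s + r)) (S (s + r)) w (gS (s + r)) w0 (@bS (s + r)) v 0 r B (ltW r0) B0.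
have {}cmp : nrm (v (0 + r) - S (s + r) r (v 0)) <= expR (w * r) * B * r.
  apply: cmp => t; rewrite add0r => /andP[t0 tr].
    apply: contpt_sub (sg_cont (gS s) y t0) => q /=.
    by rewrite !in_itv /= => /andP[-> _].
  have Dv : D (v t) by rewrite ys//; apply: smooth; lra.
  split=> //; exists (A s (v t)); first exact: sg_rder.
  rewrite nrmBC; apply: (le_trans (HA Dv (lexx s) _)); first by lra.
  rewrite addrAC subrr add0r gtr0_norm// -mulrA ler_wpM2l ?mulr_ge0 ?powR_ge0//.
  apply: interp_le; rewrite ?nrm_ge0// ys//.
    apply: (le_trans (bAS _ _ _ _)); [lra|lra|].
    rewrite mulrAC /M; apply: ler_pM; rewrite ?mulr_ge0 ?nrm_ge0 ?invr_ge0//; first by lra.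
      by rewrite ler_wpM2r ?nrm_ge0// lerDl expR_ge0.
    by rewrite lef_pV2 ?posrE//; lra.
  apply: (le_trans (sg_bound w0 (@bS (s)) x (_ : 0 <= t + r) (_ : t + r <= k))); [lra|lra|].
  by rewrite ler_wpM2r ?nrm_ge0// lerDr.
have vr : v r = S s h x by rewrite ys -?hE ?(ltW r0).
rewrite add0r vr /v (sg0 (gS s)) BE in cmp; apply: (le_trans cmp).
have rh : r <= h by lra.
have rg : r * r `^ g <= h * h `^ g.
  apply: ler_pM; rewrite ?powR_ge0 ?(ltW r0)//.
  by rewrite ge0_ler_powR ?nnegrE ?(ltW h0) ?(ltW r0) ?(ltW g0).
rewrite (_ : _ * r = expR (w * r) * (C * M * (r * r `^ g))); last by ring.
rewrite (_ : _ * nrm x = expR (w * k) * (C * M * (h * h `^ g))); last by rewrite /M /half_const; ring.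
have CM : 0 <= C * M by exact: mulr_ge0.
apply: ler_pM; rewrite ?expR_ge0//.
- by apply: mulr_ge0 => //; rewrite mulr_ge0 ?powR_ge0 ?(ltW r0).
- by rewrite ler_expR ler_wpM2l//; lra.
- by rewrite ler_wpM2l.
Qed.

(** The left-endpoint product formula on [2 ^ j] equal steps of [[s, s + h]], in the recursive form
    that suits halving. *)
Fixpoint dyadic j s h : X -> X :=
  if j is i.+1 then dyadic i (s + h / 2) (h / 2) \o dyadic i s (h / 2) else S s h.

Lemma dyadic_lin j s h : 0 <= h -> linear_op (dyadic j s h).
Proof.
elim: j s h => [|j IH] s h h0 /=; first exact: (sg_lin (gS s)).
have h20 : 0 <= h / 2 by rewrite divr_ge0.
by move=> a x y /=; rewrite !IH.
Qed.

Lemma dyadic_bound j s h : 0 <= h -> opnorm_le (dyadic j s h) (expR (w * h)).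
Proof.
elim: j s h => [|j IH] s h h0 x /=; first exact: bS.
have h20 : 0 <= h / 2 by rewrite divr_ge0.
apply: (le_trans (IH _ _ h20 _)).
apply: (le_trans (ler_wpM2l (expR_ge0 _) (IH _ _ h20 _))).
by rewrite mulrA -expRD -mulrDr -splitr.
Qed.

Lemma half_const_ge0 : 0 <= half_const.
Proof. by rewrite /half_const !mulr_ge0 ?addr_ge0 ?expR_ge0. Qed.

(** A geometric series: each refinement has twice as many local errors, each smaller by
    [2 ^ - (1 + g)], so its total shrinks by [2 ^ - g]. *)
Definition dyadic_const := half_const / (1 - 2^-1 `^ g).

Lemma half_powR_lt1 (b : R) : 0 < b -> 0 < 2^-1 `^ b < (1 : R).
Proof.
move=> bp; rewrite powR_gt0 ?invr_gt0//=.
rewrite -[X in _ < X](congr1 (fun f => f b) (powR1 R)).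
by rewrite gt0_ltr_powR ?nnegrE ?invr_ge0// invf_lt1// ltr1n.
Qed.

Lemma dyadic_const_ge0 : 0 <= dyadic_const.
Proof.
have /andP[_ q1] := half_powR_lt1 g0.
by rewrite /dyadic_const divr_ge0 ?half_const_ge0// subr_ge0 ltW.
Qed.

(* The factor expR (w * h) absorbs the growth of the propagators, so that the
   halving recursion closes with one constant. *)
Lemma dyadic_close j s h x : 0 < h -> h <= k ->
  nrm (S s h x - dyadic j s h x) <=
  dyadic_const * expR (w * h) * (h * h `^ g) * nrm x.
Proof.
have /andP[q0 q1] := half_powR_lt1 g0; set q := 2^-1 `^ g in q0 q1.
have hc0 := half_const_ge0.
have dc : half_const = dyadic_const * (1 - q) by rewrite /dyadic_const -/q divfK// subr_eq0 gt_eqF.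
have dc0 := dyadic_const_ge0.
move: dyadic_const dc dc0 => d dc dc0; elim: j s h x => [|j IH] s h x h0 hk.
  by rewrite /= subrr nrm0 !mulr_ge0 ?expR_ge0 ?powR_ge0 ?nrm_ge0 ?(ltW h0).
pose r := h / 2; have r0 : 0 < r by rewrite divr_gt0.
have hr : h = r + r by rewrite /r -splitr.
have rk : r <= k by lra.
set E := expR (w * r).
have EE : expR (w * h) = E * E by rewrite hr mulrDr expRD.
have E0 : 0 < E by exact: expR_gt0.
have E1 : 1 <= E by rewrite -expR0 ler_expR mulr_ge0// ltW.
(* Each half contributes [q / 2] of the full bound, so the recursion has ratio [q < 1]. *)
have rg : r * r `^ g = q / 2 * (h * h `^ g).
  by rewrite /r powRM ?(ltW h0)// -/q; ring.
set P := h * h `^ g in rg *.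
have P0 : 0 <= P by rewrite mulr_ge0 ?powR_ge0 ?(ltW h0).
have n0 := nrm_ge0 x; set n := nrm x in n0 *.
rewrite /=.
apply: (le_trans (nrm_tri (S (s + r) r (S s r x)) _ _)).
have b1 := half_step s x h0 hk.
have b2 : nrm (S (s + r) r (S s r x) - dyadic j (s + r) r (dyadic j s r x)) <=
  d * E * (q / 2 * P) * (E * n) + E * (d * E * (q / 2 * P) * n).
  apply: (le_trans (nrm_tri (dyadic j (s + r) r (S s r x)) _ _)); apply: lerD.
    apply: (le_trans (IH _ _ _ r0 rk)); rewrite -rg -/E; apply: ler_wpM2l.
      exact: mulr_ge0 (mulr_ge0 dc0 (ltW E0)) (mulr_ge0 (ltW r0) (powR_ge0 _ _)).
    exact: bS (ltW r0) _.
  rewrite -(linB (dyadic_lin _ _ (ltW r0))).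
  apply: (le_trans (dyadic_bound _ _ (ltW r0) _)).
  rewrite -/E ler_pM2l// -rg; exact: IH.
apply: (le_trans (lerD b1 b2)); rewrite dc EE -/P -/n.
have q1r : 0 <= 1 - q by rewrite subr_ge0 ltW.
have K0 : 0 <= d * (1 - q) * P * n := mulr_ge0 (mulr_ge0 (mulr_ge0 dc0 q1r) P0) n0.
have : d * (1 - q) * P * n <= E * E * (d * (1 - q) * P * n).
  by rewrite ler_peMl// mulr_ege1.
lra.
Qed.

(** * Regular solutions as limits of the dyadic products *)

Section Solution.
Variables (u : R -> X) (a0 c0 Ku : R).
Hypothesis cu : forall s, a0 <= s <= c0 -> contpt `[a0, c0] u s.
Hypothesis du : forall s, a0 <= s <= c0 -> D (u s) /\ rder u s (A s (u s)).
Hypothesis bu : forall s, a0 <= s <= c0 -> nrm (A s (u s)) <= Ku /\ nrm (u s) <= Ku.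

(** The defect is [(A s - A a) (u s)], and (H) at the right end [tau = s] bounds it through
    [A s (u s)]. The order is [1 + beta], but the constant involves [Ku]. *)
Lemma solution_step a h : 0 < h -> a0 <= a -> a + h <= c0 ->
  nrm (u (a + h) - S a h (u a)) <= expR (w * h) * (C * h `^ beta * Ku) * h.
Proof.
move=> h0 aa ahc.
have Ku0 : 0 <= Ku by have [|+ _] := @bu a; [lra|apply: le_trans; exact: nrm_ge0].
apply: (@sg_compare R X D (A a) (S a) w (gS a) w0 (@bS (a)) u a h _ (ltW h0)).
- by rewrite !mulr_ge0 ?powR_ge0.
- move=> s /andP[s1 s2]; apply: (@contpt_sub _ `[a0, c0]); last by apply: cu; lra.
  by move=> q /=; rewrite !in_itv /= => /andP[q1 q2]; lra.
- move=> s /andP[s1 s2]; have sI : a0 <= s <= c0 by lra.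
  have [Ds rs] := du sI; have [b1 b2] := bu sI.
  split=> //; exists (A s (u s)) => //.
  apply: (le_trans (HA Ds s1 (lexx s))).
  rewrite -mulrA -(powR_interp Ku0); apply: ler_pM; rewrite ?mulr_ge0 ?powR_ge0//.
    rewrite ler_wpM2l// ge0_ler_powR ?nnegrE ?normr_ge0 ?(ltW h0) ?(ltW b0)//.
    by rewrite ger0_norm; lra.
  by apply: interp_le; rewrite ?nrm_ge0.
Qed.

(** By stability the local errors add up: [2 ^ j] steps of length [h / 2 ^ j], each of order
    [1 + beta], leave a factor [2 ^ - (beta j)]. *)
Lemma dyadic_solution j a h : 0 < h -> a0 <= a -> a + h <= c0 ->
  nrm (u (a + h) - dyadic j a h (u a)) <=
  C * Ku * h * expR (w * h) * (h `^ beta * (2^-1 `^ beta) ^+ j).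
Proof.
elim: j a h => [|j IH] a h h0 aa ahc.
  apply: (le_trans (solution_step h0 aa ahc)).
  by rewrite le_eqVlt; apply/orP; left; apply/eqP; rewrite expr0; ring.
pose r := h / 2; have r0 : 0 < r by rewrite divr_gt0.
have hr : h = r + r by rewrite /r -splitr.
have rb : r `^ beta = h `^ beta * 2^-1 `^ beta by rewrite /r powRM// ltW.
have b1 := IH a r r0 aa (_ : a + r <= c0).
have b2 := IH (a + r) r r0 (_ : a0 <= a + r) (_ : a + r + r <= c0).
rewrite /= -/r; rewrite [in u (a + h)]hr addrA.
apply: (le_trans (nrm_tri (dyadic j (a + r) r (u (a + r))) _ _)).
rewrite -(linB (dyadic_lin _ _ (ltW r0))).
have b3 := dyadic_bound j (a + r) (ltW r0) (u (a + r) - dyadic j a r (u a)).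
have {}b1 := le_trans b3 (ler_wpM2l (expR_ge0 _) (b1 _)).
have E1 : 1 <= expR (w * r) by rewrite -expR0 ler_expR mulr_ge0// ltW.
apply: (le_trans (lerD (b2 _ _) (b1 _))); [lra|lra|lra|].
have Ku0 : 0 <= Ku by have [|+ _] := @bu a; [lra|apply: le_trans; exact: nrm_ge0].
rewrite [in expR (w * h)]hr mulrDr expRD exprS rb.
set E := expR (w * r) in E1 *; set hb := h `^ beta; set q := 2^-1 `^ beta.
have Z0 : 0 <= C * Ku * r * E * (hb * q * q ^+ j).
  have q0 : 0 <= q by exact: powR_ge0.
  have hb0 : 0 <= hb by exact: powR_ge0.
  have E0 : 0 <= E by exact: expR_ge0.
  exact: mulr_ge0 (mulr_ge0 (mulr_ge0 (mulr_ge0 C0 Ku0) (ltW r0)) E0)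
    (mulr_ge0 (mulr_ge0 hb0 q0) (exprn_ge0 _ q0)).
have : C * Ku * r * E * (hb * q * q ^+ j) <= E * (C * Ku * r * E * (hb * q * q ^+ j)).
  by rewrite ler_peMl.
have -> : C * Ku * h * (E * E) * (hb * (q * q ^+ j)) = 2 * (E * (C * Ku * r * E * (hb * q * q ^+ j))).
  by rewrite [in LHS]hr; ring.
lra.
Qed.

Lemma geometric_small (c e q : R) : 0 < e -> 0 <= q < 1 -> exists j, c * q ^+ j <= e.
Proof.
move=> e0 /andP[q0 q1]; have c1 : 0 < `|c| + 1 by rewrite ltr_wpDl.
have /cvgrPdist_le/(_ _ (divr_gt0 e0 c1)) : (q ^+ j @[j --> \oo] --> 0) by apply: cvg_expr; rewrite ger0_norm.
move=> [j _ /(_ j (leqnn j))] /=; rewrite sub0r normrN ger0_norm ?exprn_ge0// => h.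
exists j; apply: (@le_trans _ _ ((`|c| + 1) * (e / (`|c| + 1)))).
  apply: (@le_trans _ _ ((`|c| + 1) * q ^+ j)); last by rewrite ler_pM2l.
  by rewrite ler_wpM2r ?exprn_ge0//; have := ler_norm c; lra.
by rewrite mulrCA mulfV ?mulr1// gt_eqF.
Qed.

(** As [j] grows the dyadic products converge to [u], while [dyadic_close] is uniform in [j]; [Ku]
    affects only the speed of convergence and drops out. *)
Lemma solution_close a h : 0 < h -> h <= k -> a0 <= a -> a + h <= c0 ->
  nrm (S a h (u a) - u (a + h)) <=
  dyadic_const * expR (w * h) * (h * h `^ g) * nrm (u a).
Proof.
move=> h0 hk aa ahc; apply/ler_addgt0Pr => e e0.
have /andP[q0 q1] := half_powR_lt1 b0.
have [j hj] := @geometric_small (C * Ku * h * expR (w * h) * h `^ beta) e (2^-1 `^ beta) e0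
  (introT andP (conj (ltW q0) q1)).
apply: (le_trans (nrm_tri (dyadic j a h (u a)) _ _)); apply: lerD; first exact: dyadic_close.
by rewrite nrmBC; apply: (le_trans (dyadic_solution j h0 aa ahc)); rewrite mulrA.
Qed.

End Solution.

(** The 2 sums the series of halvings towards the left end, whose ratio is at most 1/2. *)
Definition local_const := 2 * (half_const + dyadic_const).

Lemma local_const_ge0 : 0 <= local_const.
Proof. by rewrite mulr_ge0// addr_ge0 ?half_const_ge0 ?dyadic_const_ge0. Qed.

(** * The step that starts at the initial time of a classical solution *)

Section FirstStep.
Variables (s : R) (x : X) (u : R -> X).
Hypothesis us : u s = x.
Hypothesis cu : forall t, s <= t -> contpt `[s, +oo[ u t.
Hypothesis du : forall t, s < t -> D (u t) /\ rder u t (A t (u t)).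
Hypothesis cAu : forall t, s < t -> {for t, continuous (fun r => A r (u r))}.
Hypothesis bu : forall t, s <= t -> nrm (u t) <= expR (w * (t - s)) * nrm x.

Lemma continuous_nrm_bounded (f : R -> X) (a b : R) : a <= b ->
  (forall t, a <= t <= b -> {for t, continuous f}) ->
  exists K, forall t, a <= t <= b -> nrm (f t) <= K.
Proof.
move=> ab' cf; have cn : {within `[a, b], continuous (fun t => nrm (f t))}.
  apply: continuous_in_subspaceT => t /[!inE] /=; rewrite in_itv /= => /cf ct.
  apply/cvgrPdist_le => e e0.
  have H := (@nrm_cvgP _ _ _ _ _ f (f t)).1 ct e e0.
  near=> r; have : nrm (f t - f r) <= e by near: r; exact: H.
  apply: le_trans; rewrite ler_norml; apply/andP; split.
    by have := nrmD (f r - f t) (f t); rewrite subrK [in X in _ <= X -> _]nrmBC; lra.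
  by have := nrmD (f t - f r) (f r); rewrite subrK; lra.
have [c _ hc] := EVT_max ab' cn; exists (nrm (f c)) => t tI.
by apply: hc; rewrite in_itv.
Unshelve. all: by end_near.
Qed.

(* The solution need not be differentiable at s, so the interval is halved
   towards s. *)
Lemma first_step_halving i h : 0 < h -> h <= k ->
  nrm (S s h x - u (s + h)) <=
  local_const * expR (w * h) * (h * h `^ g) * nrm x +
  expR (w * h) * nrm (S s (h / 2 ^+ i) x - u (s + h / 2 ^+ i)).
Proof.
have n0 := nrm_ge0 x; have hc0 := half_const_ge0.
have dc0 := dyadic_const_ge0; have K0 := local_const_ge0.
elim: i h => [|i IH] h h0 hk.
  rewrite expr0 divr1; set q := nrm (S _ _ _ - _).
  have P0 : 0 <= h * h `^ g := mulr_ge0 (ltW h0) (powR_ge0 _ _).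
  have E1 : 1 <= expR (w * h) by rewrite -expR0 ler_expR mulr_ge0// ltW.
  have q0 : 0 <= q by exact: nrm_ge0.
  have := mulr_ge0 (mulr_ge0 (mulr_ge0 K0 (le_trans ler01 E1)) P0) n0.
  have : q <= expR (w * h) * q by rewrite ler_peMl.
  lra.
pose r := h / 2; have r0 : 0 < r by rewrite divr_gt0.
have hr : h = r + r by rewrite /r -splitr.
have rk : r <= k by lra.
set E := expR (w * r).
have EE : expR (w * h) = E * E by rewrite [in LHS]hr mulrDr expRD.
have E1 : 1 <= E by rewrite -expR0 ler_expR mulr_ge0// ltW.
have E0 : 0 <= E := le_trans ler01 E1.
have rg : r * r `^ g <= (h * h `^ g) / 2.
  rewrite [X in _ <= X]mulrAC -/r ler_wpM2l ?(ltW r0)//.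
  by rewrite ge0_ler_powR ?nnegrE ?(ltW h0) ?(ltW r0) ?(ltW g0)//; lra.
set P := h * h `^ g in rg *.
have P0 : 0 <= P := mulr_ge0 (ltW h0) (powR_ge0 _ _).
have r2 : r / 2 ^+ i = h / 2 ^+ i.+1 by rewrite exprS invfM mulrA.
have sr : s < s + r by rewrite ltrDl.
have srr : s + r + r = s + h by rewrite -addrA -hr.
have b1 := half_step s x h0 hk.
(* Left half: the induction hypothesis, carried over by the semigroup frozen at the midpoint. *)
have b2 : nrm (S (s + r) r (S s r x) - S (s + r) r (u (s + r))) <=
    E * (local_const * E * (P / 2) * nrm x + E * nrm (S s (r / 2 ^+ i) x - u (s + r / 2 ^+ i))).
  rewrite -(linB (sg_lin (gS (s + r)) (ltW r0))).
  apply: (le_trans (bS _ (ltW r0) _)); rewrite -/E ler_wpM2l//.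
  apply: (le_trans (IH r r0 rk)); rewrite lerD2r ler_wpM2r//.
  by rewrite ler_wpM2l// mulr_ge0.
(* Right half: it stays away from [s], so [A t (u t)] is continuous and hence bounded there, as
   [solution_close] requires. *)
have b3 : nrm (S (s + r) r (u (s + r)) - u (s + r + r)) <=
    dyadic_const * E * (P / 2) * (E * nrm x).
  have [K1 hK1] := @continuous_nrm_bounded (fun t => A t (u t)) (s + r) (s + h)
    ltac:(lra) ltac:(by move=> t /andP[t1 _]; apply: cAu; lra).
  pose Ku := Num.max K1 (expR (w * h) * nrm x).
  apply: (le_trans (@solution_close u (s + r) (s + h) Ku _ _ _ (s + r) r r0 rk (lexx _) _)).
  - move=> t /andP[t1 t2]; apply: (@contpt_sub _ `[s, +oo[); last by apply: cu; lra.
    by move=> q /=; rewrite !in_itv /= => /andP[q1 q2]; lra.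
  - by move=> t /andP[t1 t2]; apply: du; lra.
  - move=> t tI; split; first by rewrite /Ku le_max hK1.
    case/andP: tI => t1 t2; rewrite /Ku le_max; apply/orP; right.
    apply: (le_trans (bu _)); first by lra.
    by rewrite ler_wpM2r// ler_expR ler_wpM2l//; lra.
  - by rewrite srr.
  have ub : nrm (u (s + r)) <= E * nrm x.
    by have := bu (ltW sr); rewrite addrAC subrr add0r.
  apply: ler_pM => //; rewrite ?nrm_ge0//.
    exact: mulr_ge0 (mulr_ge0 dc0 E0) (mulr_ge0 (ltW r0) (powR_ge0 _ _)).
  by rewrite ler_wpM2l// mulr_ge0.
apply: (le_trans (nrm_tri (S (s + r) r (S s r x)) _ _)).
have b4 := nrm_tri (S (s + r) r (u (s + r))) (S (s + r) r (S s r x)) (u (s + h)).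
rewrite srr in b3; rewrite -r2 EE -/P in b1 *.
set Q := nrm (S s (r / _) x - _) in b2 *.
have b14 := lerD b1 (le_trans b4 (lerD b2 b3)).
apply: (le_trans b14); rewrite /local_const.
have KP : 0 <= half_const * P * nrm x := mulr_ge0 (mulr_ge0 hc0 P0) n0.
have : half_const * P * nrm x <= E * E * (half_const * P * nrm x).
  by rewrite ler_peMl// mulr_ege1.
have : 0 <= E * E * (dyadic_const * P * nrm x).
  exact: mulr_ge0 (mulr_ge0 E0 E0) (mulr_ge0 (mulr_ge0 dc0 P0) n0).
lra.
Qed.

(** As [i] grows, both vectors in the remainder of [first_step_halving] tend to [x], by continuity
    of the orbit at 0 and of [u] at [s]. *)
Lemma first_step h : 0 < h -> h <= k ->
  nrm (S s h x - u (s + h)) <= local_const * expR (w * h) * (h * h `^ g) * nrm x.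
Proof.
move=> h0 hk; apply/ler_addgt0Pr => e e0.
pose e' := e / expR (w * h) / 2.
have e'0 : 0 < e' by rewrite !divr_gt0 ?expR_gt0.
have [d1 d10 h1] := sg_cont (gS s) x (lexx 0) e'0.
have [d2 d20 h2] := cu (lexx s) e'0.
pose d := Num.min d1 d2; have d0 : 0 < d by rewrite lt_min d10.
have [i hi] := @geometric_small h (d / 2) 2^-1 ltac:(by rewrite divr_gt0) ltac:(lra).
have {}hi : 0 < h / 2 ^+ i < d.
  by rewrite divr_gt0 ?exprn_gt0//=; rewrite -exprVn; lra.
case/andP: hi => hi0; rewrite lt_min => /andP[hd1 hd2].
apply: (le_trans (first_step_halving i h0 hk)); rewrite lerD2l.
have -> : e = expR (w * h) * (e' + e') by rewrite /e' -splitr mulrCA mulfV ?mulr1// gt_eqF ?expR_gt0.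
rewrite ler_pM2l ?expR_gt0//; apply: (le_trans (nrm_tri x _ _)); apply: lerD.
  have := h1 (h / 2 ^+ i); rewrite (sg0 (gS s)); apply; last by rewrite subr0 gtr0_norm.
  by rewrite /= in_itv /= (ltW hi0).
rewrite -us nrmBC; apply: h2; last by rewrite addrAC subrr add0r gtr0_norm.
by rewrite /= in_itv /= lerDl (ltW hi0).
Qed.

End FirstStep.

End Splitting.

(** An a priori bound [c], however crude, makes [f] continuous, so the sharper [K] passes to the
    closure of [Y]. *)
Lemma dense_opnorm_le (R : realType) (X : completeNormedModType R[i])
    (Y : set X) (f : X -> X) (c K : R) : closure Y = setT -> 0 <= c -> 0 <= K ->
  linear_op f -> opnorm_le f c -> (forall y, Y y -> nrm (f y) <= K * nrm y) ->
  opnorm_le f K.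
Proof.
move=> dY c0 K0 lf bf hY x; apply/ler_addgt0Pr => e e0.
have cK : 0 < c + K + 1 by rewrite ltr_wpDl// addr_ge0.
pose d := e / (c + K + 1); have d0 : 0 < d by rewrite divr_gt0.
have dC : 0 < d%:C by rewrite ltcR.
have : closure Y x by rewrite dY.
move=> /(_ _ (nbhsx_ballx x _ dC))[y [Yy]].
rewrite -ball_normE /= nrmE ltcR => xy.
have xy' : nrm (x - y) <= d by exact: ltW.
have yn : nrm y <= nrm x + d.
  by have := nrmB x (x - y); rewrite opprB addrC subrK; lra.
rewrite -[x in f x](subrK y) (linD lf); apply: (le_trans (nrmD _ _)).
have b1 := le_trans (bf (x - y)) (ler_wpM2l c0 xy').
have b2 := le_trans (hY y Yy) (ler_wpM2l K0 yn).
apply: (le_trans (lerD b1 b2)).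
have -> : e = (c + K + 1) * d by rewrite /d mulrCA mulfV ?mulr1// gt_eqF.
lra.
Qed.

(** * The case [alpha >= 1]: a constant family *)

Section ConstantFamily.
Variables (R : realType) (X : completeNormedModType R[i]).

Lemma powR_small (Q b e : R) : 0 <= Q -> 0 < b -> 0 < e ->
  exists2 d : R, 0 < d & forall h, 0 <= h -> h < d -> Q * h `^ b <= e.
Proof.
move=> Q0 b0 e0; have Q1 : 0 < Q + 1 by rewrite ltr_wpDl.
have eQ : 0 < e / (Q + 1) by rewrite divr_gt0.
exists ((e / (Q + 1)) `^ b^-1); first exact: powR_gt0.
move=> h h0 hd; have : h `^ b <= e / (Q + 1).
  apply: (@le_trans _ _ (((e / (Q + 1)) `^ b^-1) `^ b)).
    by rewrite ge0_ler_powR ?nnegrE ?powR_ge0 ?(ltW b0) ?(ltW hd).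
  by rewrite -powRrM mulVf ?gt_eqF// powRr1// ltW.
move=> /(ler_wpM2l Q0) h1; apply: (le_trans h1).
by rewrite mulrCA ger_pMr// ler_pdivrMr// mul1r lerDl.
Qed.

(** An exponent above 1 makes the right derivative vanish, so the mean value inequality applies with
    [B = 0]. *)
Lemma holder_gt1_constant (f : R -> X) (a b Q beta : R) : a <= b -> 0 <= Q -> 1 < beta ->
  (forall s t, a <= s -> s <= t -> t <= b -> nrm (f t - f s) <= Q * (t - s) `^ beta) ->
  f b = f a.
Proof.
move=> ab Q0 b1 H; have b0 : 0 < beta by exact: lt_trans b1.
apply: (@nrm_le_eps _ _ _ _ 0) => // e1 _; rewrite mul0r {e1}.
rewrite -[X in _ <= X](mul0r (b - a)); apply: mean_value_le => //.
- move=> s /andP[as_ sb] e e0; have [d d0 hd] := powR_small Q0 b0 e0.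
  exists d => // t /=; rewrite in_itv /= => /andP[at_ tb].
  have [st|ts] := leP s t.
    rewrite ger0_norm ?subr_ge0// => td; apply: le_trans (hd _ _ td); first exact: H.
    by rewrite subr_ge0.
  rewrite ltr0_norm ?subr_lt0// opprB => td; rewrite nrmBC.
  apply: le_trans (hd _ _ td); first by apply: H => //; exact: ltW.
  by rewrite subr_ge0 ltW.
- move=> s /andP[as_ sb] e e0; have b10 : 0 < beta - 1 by rewrite subr_gt0.
  have [d d0 hd] := powR_small Q0 b10 e0.
  exists (Num.min d (b - s)); first by rewrite lt_min d0 subr_gt0.
  move=> h h0; rewrite lt_min => /andP[h1 h2].
  have := H s (s + h) as_; rewrite lerDl (ltW h0) => /(_ isT).
  rewrite addrAC subrr add0r add0r => /(_ _) Hh.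
  apply: (le_trans (Hh _)); first by lra.
  rewrite -(mulr_powRB1 (ltW h0) b0) mulrCA mulrC ler_wpM2r ?(ltW h0)//.
  by apply: hd => //; exact: ltW.
Qed.

Variables (D : set X) (A : R -> X -> X) (L theta alpha beta C : R) (A0inv : X -> X).
Hypothesis A0K : forall x, D x -> A0inv (A 0 x) = x.
Hypothesis L0 : 0 <= L.
Hypothesis theta0 : 0 <= theta.
Hypothesis P3 : forall t s, opnorm_le (fun y => A t (A0inv y) - A s (A0inv y))
                           (L * `|t - s| `^ theta).
Hypothesis alpha0 : 0 <= alpha.
Hypothesis beta1 : 1 < beta.
Hypothesis C0 : 0 <= C.
Hypothesis HA : forall x s tau t, D x -> s <= tau -> tau <= t ->
  nrm (A t x - A s x)
    <= C * `|t - s| `^ beta * nrm (A tau x) `^ alpha * nrm x `^ (1 - alpha).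

(** On [[s, t]], (P3) bounds the norm of [A r x] uniformly, and (H) then makes [A r x] Holder
    continuous in [r] with exponent [beta > 1]. *)
Lemma family_constant s t x : D x -> s <= t -> A t x = A s x.
Proof.
move=> Dx st; pose m := `|s| + `|t|.
have m0 : 0 <= m by rewrite addr_ge0.
pose K := nrm (A 0 x) + L * m `^ theta * nrm (A 0 x).
have K0 : 0 <= K by rewrite addr_ge0 ?mulr_ge0 ?powR_ge0 ?nrm_ge0.
have AK r : s <= r -> r <= t -> nrm (A r x) <= K.
  move=> sr rt; rewrite -[A r x](subrK (A 0 x)) addrC.
  apply: (le_trans (nrmD _ _)); rewrite lerD2l.
  have := P3 r 0 (A 0 x); rewrite A0K// subr0 => h; apply: (le_trans h).
  rewrite ler_wpM2r ?nrm_ge0// ler_wpM2l// ge0_ler_powR ?nnegrE//.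
  have := ler_norm t; have := ler_norm (- s); rewrite normrN /m => h1 h2.
  have := normr_ge0 s; have := normr_ge0 t.
  by rewrite ler_norml; lra.
apply: (@holder_gt1_constant (fun r => A r x) s t (C * K `^ alpha * nrm x `^ (1 - alpha)) beta) => //.
  by rewrite !mulr_ge0 ?powR_ge0.
move=> p q sp pq qt; apply: (le_trans (HA Dx (lexx p) pq)).
rewrite (_ : _ * (q - p) `^ beta = C * (q - p) `^ beta * K `^ alpha * nrm x `^ (1 - alpha)); last by ring.
rewrite ger0_norm ?subr_ge0// ler_wpM2r ?powR_ge0// ler_wpM2l ?mulr_ge0 ?powR_ge0//.
by rewrite ge0_ler_powR ?nnegrE ?nrm_ge0// AK// (le_trans pq).
Qed.

End ConstantFamily.

(** * Accumulation of the local errors *)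

Section Telescope.
Variables (R : realType) (X : completeNormedModType R[i]).
Variables (S U : R -> R -> X -> X) (w K g h : R).
Hypothesis w0 : 0 <= w.
Hypothesis h0 : 0 < h.
Hypothesis K0 : 0 <= K.
Hypothesis lS : forall t tau, 0 <= tau -> linear_op (S t tau).
Hypothesis bS : forall t tau, 0 <= tau -> opnorm_le (S t tau) (expR (w * tau)).
Hypothesis U0 : forall x, U 0 0 x = x.
Hypothesis UU : forall t r s, s <= r -> r <= t -> forall x, U t r (U r s x) = U t s x.
Hypothesis bU : forall t s, s <= t -> opnorm_le (U t s) (expR (w * (t - s))).
Hypothesis local : forall s x,
  nrm (U (s + h) s x - S s h x) <= K * (h * h `^ g) * nrm x.

Lemma telescope_error n x :
  nrm (U (n%:R * h) 0 x - oprod (fun k => S (k%:R * h) h) n x) <=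
  n%:R * (K * (h * h `^ g)) * expR (w * (n%:R * h)) * nrm x.
Proof.
have hg0 : 0 <= K * (h * h `^ g) by rewrite !mulr_ge0 ?powR_ge0 ?(ltW h0).
elim: n => [|n IH]; first by rewrite !mul0r U0 subrr nrm0.
have nh : 0 <= n%:R * h by rewrite mulr_ge0// ltW.
have -> : n.+1%:R * h = n%:R * h + h by rewrite -natr1 mulrDl mul1r.
rewrite -(UU nh (_ : _ <= n%:R * h + h)); last by rewrite lerDl ltW.
rewrite /=; set u := U (n%:R * h) 0 x in IH *.
apply: (le_trans (nrm_tri (S (n%:R * h) h u) _ _)).
rewrite -(linB (lS _ (ltW h0))).
have ub : nrm u <= expR (w * (n%:R * h)) * nrm x.
  by have := bU nh x; rewrite subr0.
have b1 := le_trans (local _ u) (ler_wpM2l hg0 ub).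
have b2 := le_trans (@bS (n%:R * h) _ (ltW h0) _) (ler_wpM2l (expR_ge0 _) IH).
apply: (le_trans (lerD (b1 _) b2)).
rewrite mulrDr expRD -natr1 mulrDl mul1r.
set E := expR (w * (n%:R * h)); set F := expR (w * h); set q := K * _.
have F1 : 1 <= F by rewrite -expR0 ler_expR mulr_ge0// ltW.
have Eq : 0 <= q * E * nrm x := mulr_ge0 (mulr_ge0 hg0 (expR_ge0 _)) (nrm_ge0 x).
have : q * E * nrm x <= F * (q * E * nrm x) by rewrite ler_peMl.
lra.
Qed.

End Telescope.

(* Assembly of the estimates *)
Local Close Scope complex_scope.
Unset Implicit Arguments.
Set Strict Implicit.

Theorem mainTheorem11 (R : realType) (X : completeNormedModType R[i])
  (D : set X) (A : R -> X -> X) (S : R -> R -> X -> X) (U : R -> R -> X -> X)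
  (M0 omega L theta alpha beta C : R) :
  (* (P1) is built in: every A t has the same domain D *)
  (* (P2) *)
  (forall t, sectorial D (A t)) ->
  (forall t, generates_C0 D (A t) (S t)) ->
  (forall t, analytic_semigroup (S t)) ->
  1 <= M0 ->
  (forall t (z : R[i]), 0 <= complex.Re z ->
     exists Rz, is_resolvent D (A t) z Rz /\ opnorm_le Rz (M0 / (cabs z + 1))) ->
  (forall t tau, 0 <= tau -> opnorm_le (S t tau) (expR (omega * tau))) ->
  (* (P3) *)
  0 <= L -> 0 < theta <= 1 ->
  (forall Ainv : X -> X, (forall y, D (Ainv y) /\ A 0 (Ainv y) = y) ->
     forall t s, opnorm_le (fun y => A t (Ainv y) - A s (Ainv y))
                           (L * `|t - s| `^ theta)) ->
  (* (H) *)
  0 <= alpha < beta -> 0 < C ->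
  (forall x s tau t, D x -> s <= tau -> tau <= t ->
     nrm (A t x - A s x)
       <= C * `|t - s| `^ beta * nrm (A tau x) `^ alpha * nrm x `^ (1 - alpha)) ->
  (* the evolution family *)
  evolution_family D A U ->
  (forall t s, s <= t -> opnorm_le (U t s) (expR (omega * (t - s)))) ->
  forall T : R, 0 < T -> exists CT : R, forall M : nat, (1 <= M)%N ->
    opnorm_le
      (fun x => U T 0 x
          - oprod (fun k => S (k%:R * (T / M%:R)) (T / M%:R)) M x)
      (CT * (T / M%:R) `^ (beta - alpha)).
Proof.
move=> sec gS anS M01 res bS0 L0 /andP[th0 _] P3 /andP[a0 ab] C0 HA [linU UU U0 _ [Y [sY dY solY]]] bU0 T T0.
(* Passing to the absolute value of [omega] weakens the growth bounds but makes them nondecreasing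
   in time. *)
pose w := `|omega|; have w0 : 0 <= w by exact: normr_ge0.
have wle tau : 0 <= tau -> expR (omega * tau) <= expR (w * tau).
  by move=> t0; rewrite ler_expR ler_wpM2r// ler_norm.
have lA t : linear_on D (A t) by case: (sec t).
have bS t tau : 0 <= tau -> opnorm_le (S t tau) (expR (w * tau)).
  move=> t0 x; apply: (le_trans (bS0 t tau t0 x)).
  by rewrite ler_wpM2r ?nrm_ge0// wle.
have bU t s : s <= t -> opnorm_le (U t s) (expR (w * (t - s))).
  move=> st x; apply: (le_trans (bU0 t s st x)).
  by rewrite ler_wpM2r ?nrm_ge0// wle// subr_ge0.
have smooth t tau x : 0 < tau -> D (S t tau x).
  exact: (analytic_dom (gS t) (anS t)).
pose Ks := smooth_const w M0 T.
have bAS t tau x : 0 < tau -> tau <= T ->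
    nrm (A t (S t tau x)) <= Ks / tau * nrm x.
  (* A single function picks the resolvents; outside the closed right half-plane its value is a
     dummy, the identity. *)
  have /choice[Rf hRf] : forall z, exists Rz : X -> X, 0 <= complex.Re z ->
      is_resolvent D (A t) z Rz /\ opnorm_le Rz (M0 / (cabs z + 1)).
    move=> z; have [z0|z0] := boolP (0 <= complex.Re z); last by exists id.
    by have [Rz hR] := res t z z0; exists Rz.
  by apply: (@sg_gen_bound R X D (A t) (S t) w M0 (lA t) (gS t) w0 (bS t)
    (smooth t) M01 Rf) => z /hRf[].
have Ks0 : 0 <= Ks.
  by rewrite /Ks /smooth_const /ritt_const !mulr_ge0 ?expR_ge0 ?exprn_ge0 ?pi_ge0
    ?addr_ge0 ?expR_ge0 ?(le_trans ler01 M01).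
(* The interpolation estimates need an exponent at most 1. For [alpha >= 1] the family is constant,
   so (H) holds trivially with exponents [0] and [beta - alpha], which give the same rate. *)
have [al [be [a01 abe gE HA']]] : exists al be : R, [/\ 0 <= al <= 1, al < be,
    be - al = beta - alpha & forall x s tau t, D x -> s <= tau -> tau <= t ->
     nrm (A t x - A s x)
       <= C * `|t - s| `^ be * nrm (A tau x) `^ al * nrm x `^ (1 - al)].
  have [a1|a1] := ltP alpha 1; first by exists alpha, beta; rewrite a0 ltW.
  exists 0, (beta - alpha); rewrite lexx ler01 subr_gt0 subr0; split=> //.
  move=> x s tau t Dx st tt.
  (* The resolvent at 0 inverts [- A 0], hence the sign in the inverse given to (P3). *)
  have [R0 [[[lR _] R0D R0K] _]] := res 0 0 (lexx _).
  have invK y : D (- R0 y) /\ A 0 (- R0 y) = y.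
    have [DR e] := R0D y; rewrite -[- R0 y]scaleN1r.
    split; first exact: (lonZD (lA 0)).
    by rewrite (lonZ (lA 0))// scaleN1r -[RHS]e scale0r sub0r.
  rewrite (@family_constant R X D A L theta alpha beta C (fun y => - R0 y)
    _ L0 (ltW th0) (P3 _ invK) a0 (le_lt_trans a1 ab) (ltW C0) HA s t x Dx (le_trans st tt)).
    by rewrite subrr nrm0 !mulr_ge0 ?powR_ge0 ?(ltW C0).
  by move=> y Dy; have := R0K y Dy; rewrite scale0r sub0r (linN lR).
pose K := local_const w al be C T Ks * expR (w * T).
have lc0 : 0 <= local_const w al be C T Ks by apply: local_const_ge0 => //; exact: ltW.
have K0 : 0 <= K by rewrite mulr_ge0 ?expR_ge0.
have local h s x : 0 < h -> h <= T ->
    nrm (U (s + h) s x - S s h x) <= K * (h * h `^ (beta - alpha)) * nrm x.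
  move=> h0 hT; have ssh : s <= s + h by rewrite lerDl ltW.
  have P0 : 0 <= h * h `^ (beta - alpha) := mulr_ge0 (ltW h0) (powR_ge0 _ _).
  (* Classical solutions are given only for data in [Y]; the sum of the two growth bounds is the a
     priori bound for the density argument. *)
  apply: (@dense_opnorm_le R X Y (fun z => U (s + h) s z - S s h z)
    (expR (w * h) + expR (w * h)) _ dY).
  - by rewrite addr_ge0 ?expR_ge0.
  - exact: mulr_ge0.
  - have [lU _] := linU _ _ ssh; have lS := sg_lin (gS s) (ltW h0).
    by move=> c y1 y2; rewrite lU lS opprD addrACA scalerBr.
  - move=> z; rewrite mulrDl; apply: (le_trans (nrmB _ _)); apply: lerD.
      by have := bU _ _ ssh z; rewrite addrAC subrr add0r.
    exact: bS (ltW h0) z.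
  move=> y Yy; have [us cu Du du] := solY s y Yy.
  rewrite nrmBC -gE.
  have fs : nrm (S s h y - U (s + h) s y) <=
      local_const w al be C T Ks * expR (w * h) * (h * h `^ (be - al)) * nrm y.
    apply: (@first_step R X D A S w al be C T Ks gS w0 bS smooth Ks0 bAS
      (ltW C0) a01 abe HA' s y (fun t => U t s y)) => //.
    - by move=> t st; apply: within_contpt => //=; rewrite in_itv /= st.
    - by move=> t st; split; [exact: Du|have [/has_deriv_rder] := du t st].
    - by move=> t st; have [] := du t st.
    - by move=> t st; exact: bU.
  apply: (le_trans fs); rewrite ler_wpM2r ?nrm_ge0// ler_wpM2r ?gE//.
  by rewrite ler_wpM2l// ler_expR ler_wpM2l.
(* The [M] local errors of size [K * h] times the rate leave [M * h = T]; the exponential is the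
   growth up to time [T]. *)
exists (T * K * expR (w * T)) => M M1 x.
pose h := T / M%:R.
have M0' : 0 < M%:R :> R by rewrite ltr0n.
have h0 : 0 < h by rewrite divr_gt0.
have Mh : M%:R * h = T by rewrite mulrC divfK// gt_eqF.
have hT : h <= T by rewrite ler_pdivrMr// ler_peMr ?ler1n//; exact: ltW.
have := @telescope_error R X S U w K (beta - alpha) h w0 h0 K0
  (fun t tau t0 => sg_lin (gS t) t0) bS (U0 0)
  UU bU (fun s y => local h s y h0 hT) M x.
rewrite -/h Mh => H; apply: (le_trans H).
rewrite le_eqVlt; apply/orP; left; apply/eqP.
rewrite [LHS](_ : _ = M%:R * h * (K * h `^ (beta - alpha) * expR (w * T) * nrm x)); last by ring.
by rewrite Mh; ring.
Qed.
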